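(* Let $p$ be an odd prime, $r\ge1$ an integer, $V=\mathbb{F}_p^r$, $\chi$ a non-degenerate symmetric bicharacter of $V$, and $\tau$ a square root of $|V|^{-1}$. Let $k\ge1$ be an integer. The $2k$-th Frobenius-Schur indicator of $m\in\mathcal{TY}(V,\chi,\tau)$ (with its canonical pivotal structure) is given as follows: (a) If $k$ is relatively prime to $p$, $$\nu_{2k}(m)=\mathrm{sgn}(\tau)^k\,\varepsilon_p^{r(k+1)}\left(\frac{-k}{p}\right)^r\left(\frac{-2}{p}\right)^{r(k+1)}D(\chi)^{k+1}.$$ (b) If $k$ is a multiple of $p$, $$\nu_{2k}(m)=\mathrm{sgn}(\tau)^k\,\varepsilon_p^{rk}\left(\frac{-2}{p}\right)^{rk}D(\chi)^k\times p^{\frac12r}.$$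
   Context: $\left(\frac{\cdot}{p}\right)$ is the Legendre symbol; $\varepsilon_p=1$ if $p\equiv1\pmod4$ and $\varepsilon_p=\sqrt{-1}$ if $p\equiv3\pmod4$. Every bicharacter of $V=\mathbb{F}_p^r$ has the form $\chi=\chi_B$, $\chi_B(v,w)=\exp\left(\frac{2\pi\sqrt{-1}}{p}B(v,w)\right)$ for a unique $\mathbb{F}_p$-bilinear form $B$ on $V$, and $\chi_B$ is non-degenerate and symmetric iff $B$ is. For $\chi=\chi_B$ non-degenerate symmetric, $D(\chi)=\left(\frac{\det B}{p}\right)\in\{\pm1\}$, where $B$ is identified with its matrix $(B(e_i,e_j))$ in the standard basis $e_1,\dots,e_r$. Everything is over $\mathbb{C}$. A bicharacter of a finite abelian group $A$ (written multiplicatively below) is a map $\chi: A\times A\to\mathbb{C}^\times$ multiplicative in each variable; it is symmetric if $\chi(a,b)=\chi(b,a)$, and non-degenerate if $\chi(x,a)=1$ for all $x\in A$ implies $a=1$. Tambara-Yamagami category. $\mathcal{TY}(A,\chi,\tau)$ (with $\tau\in\mathbb{R}$, $\tau^2=|A|^{-1}$) is the skeletal $\mathbb{C}$-linear monoidal category whose objects are finite direct sums of elements of $S=A\sqcup\{m\}$, with $\mathrm{Hom}(s,s')=\mathbb{C}$ if $s=s'$ and $0$ otherwise ($s,s'\in S$) and the obvious composition. The tensor product is $a\otimes b=ab$, $a\otimes m=m=m\otimes a$, $m\otimes m=\bigoplus_{x\in A}x$ ($a,b\in A$). The unit object is $1\in A$ with identity unit constraints. The associativity constraint $\Phi_{X,Y,Z}:(X\otimes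 Y)\otimes Z\to X\otimes(Y\otimes Z)$ is determined by $\Phi_{a,m,b}=\chi(a,b)\,\mathrm{id}_m$, $\Phi_{m,a,m}=(\chi(a,x)\delta_{x,y}\mathrm{id}_x)_{x,y}:\bigoplus_x x\to\bigoplus_y y$, $\Phi_{m,m,m}=(\tau\chi(x,y)^{-1}\mathrm{id}_m)_{x,y}:\bigoplus_{x\in A}m\to\bigoplus_{y\in A}m$, all other $\Phi_{s,t,u}$ ($s,t,u\in S$) being identities. The left dual of $a\in A$ is $a^{-1}$ with identity coevaluation and evaluation; the left dual of $m$ is $m$ with coevaluation the injection $1\to m\otimes m$ and evaluation $\tau^{-1}p_0$, where $p_0:m\otimes m\to1$ is the projection. The bidual functor is the identity, and the canonical pivotal structure is $j_a=\mathrm{id}_a$ ($a\in A$), $j_m=\mathrm{sgn}(\tau)\,\mathrm{id}_m$. Frobenius-Schur indicators. Let $\mathcal{C}$ be a $\mathbb{C}$-linear rigid monoidal category with pivotal structure $j:\mathrm{id}\to(-)^{**}$, coevaluations $d_X:1\to X\otimes X^*$ and evaluations $b_X:X^*\otimes X\to 1$. Put $X^{\otimes0}=1$, $X^{\otimes 1}=X$, $X^{\otimes n}=X\otimes X^{\otimes(n-1)}$ for $n\ge2$. Let $A^W_{Y,Z}:\mathrm{Hom}(W,Y\otimes Z)\to\mathrm{Hom}(Y^*\otimes W,Z)$ and $B^{W,Y}_Z:\mathrm{Hom}(W\otimes Y,Z)\to\mathrm{Hom}(W,Z\otimes Y^* )$ be the standard duality isomorphisms (up to associativity, $f\mapsto(b_Y\otimes\mathrm{id}_Z)(\mathrm{id}_{Y^*}\otimes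 f)$ and $g\mapsto(g\otimes\mathrm{id}_{Y^*})(\mathrm{id}_W\otimes d_Y)$). Define the linear automorphism $E_X^{(n)}$ of $\mathrm{Hom}(1,X^{\otimes n})$ by $E_X^{(n)}(f)=\Phi\circ(\mathrm{id}_{X^{\otimes(n-1)}}\otimes j_X^{-1})\circ B^{1,X^*}_{X^{\otimes(n-1)}}(A^1_{X,X^{\otimes(n-1)}}(f))$, where $\Phi:X^{\otimes(n-1)}\otimes X\to X^{\otimes n}$ is the associativity isomorphism. The $n$-th Frobenius-Schur indicator is $\nu_n(X)=\mathrm{Tr}(E_X^{(n)})$. *)

(* Defs.v *)
From HB Require Import structures.
From mathcomp Require Import all_boot all_order all_algebra.
From mathcomp Require Import classical_sets reals exp trigo complex.

Set Implicit Arguments.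
Unset Strict Implicit.
Unset Printing Implicit Defensive.

Import GRing.Theory Num.Theory.
Local Open Scope ring_scope.
Local Open Scope complex_scope.

(* The data of an F-linear left rigid monoidal category with a pivotal
   structure: the inverse isomorphisms are not part of the data but recovered
   with [hinv], and the coherence axioms are omitted, since the definition of
   the indicators refers only to the data.
   - [assoc X Y Z : (X (x) Y) (x) Z -> X (x) (Y (x) Z)]
   - [coev X : 1 -> X (x) X^*] and [ev X : X^* (x) X -> 1]
   - [piv X : X -> X^**]  *)
Record pivotal_data (F : fieldType) := PivotalData {
  obj :> Type;
  hom : obj -> obj -> vectType F;
  idm : forall X, hom X X;
  comp : forall X Y Z, hom Y Z -> hom X Y -> hom X Z;
  one : obj;
  tens : obj -> obj -> obj;
  tensm : forall X X' Y Y',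
    hom X X' -> hom Y Y' -> hom (tens X Y) (tens X' Y');
  assoc : forall X Y Z, hom (tens (tens X Y) Z) (tens X (tens Y Z));
  lunit : forall X, hom (tens one X) X;
  runit : forall X, hom (tens X one) X;
  dual : obj -> obj;
  coev : forall X, hom one (tens X (dual X));
  ev : forall X, hom (tens (dual X) X) one;
  piv : forall X, hom X (dual (dual X)) }.

Arguments hom {F p} _ _.
Arguments idm {F p} _.
Arguments comp {F p X Y Z} _ _.
Arguments one {F} p.
Arguments tens {F p} _ _.
Arguments tensm {F p X X' Y Y'} _ _.
Arguments assoc {F p} _ _ _.
Arguments lunit {F p} _.
Arguments runit {F p} _.
Arguments dual {F p} _.
Arguments coev {F p} _.
Arguments ev {F p} _.
Arguments piv {F p} _.

Definition ltrace (F : fieldType) (U : vectType F) (f : U -> U) : F :=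
  let e := vbasis {: U} in \sum_i coord e i (f e`_i).

Section Indicators.
Variables (F : fieldType) (C : pivotal_data F).
Implicit Types (X Y Z W : C) (n : nat).

Local Notation "g \c f" := (comp g f) (at level 40, left associativity).

(* The inverse of an isomorphism (0 on non-isomorphisms). *)
Definition hinv X Y (f : hom X Y) : hom Y X :=
  xget 0 [set g : hom Y X | g \c f = idm X /\ f \c g = idm Y]%classic.

Fixpoint tpow X n : C :=
  match n with
  | 0%N => one C
  | n'.+1 => match n' with
             | 0%N => X
             | _.+1 => tens X (tpow X n')
             end
  end.

(* X (x) X^{(x) n} and X^{(x) n.+1} coincide, except for n = 0. *)
Definition tpowS X n : hom (tens X (tpow X n)) (tpow X n.+1) :=
  match n return hom (tens X (tpow X n)) (tpow X n.+1) with
  | 0%N => runit X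
  | _.+1 => idm _
  end.

Fixpoint tpow_assoc X n : hom (tens (tpow X n) X) (tpow X n.+1) :=
  match n return hom (tens (tpow X n) X) (tpow X n.+1) with
  | 0%N => lunit X
  | n'.+1 =>
    match n' return hom (tens (tpow X n') X) (tpow X n'.+1) ->
                    hom (tens (tpow X n'.+1) X) (tpow X n'.+2) with
    | 0%N => fun=> idm (tens X X)
    | n''.+1 => fun phi => tensm (idm X) phi \c assoc X (tpow X n''.+1) X
    end (tpow_assoc X n')
  end.

Definition dualA W Y Z (f : hom W (tens Y Z)) : hom (tens (dual Y) W) Z :=
  lunit Z \c tensm (ev Y) (idm Z) \c hinv (assoc (dual Y) Y Z)
    \c tensm (idm (dual Y)) f.

Definition dualB W Y Z (g : hom (tens W Y) Z) : hom W (tens Z (dual Y)) :=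
  tensm g (idm (dual Y)) \c hinv (assoc W Y (dual Y))
    \c tensm (idm W) (coev Y) \c hinv (runit W).

(* The map E_X^{(n.+1)}.  Between [dualA] and [dualB], the source X^* (x) 1 is
   turned into 1 (x) X^* by the unit constraints. *)
Definition FSmap X n (f : hom (one C) (tpow X n.+1)) :
    hom (one C) (tpow X n.+1) :=
  let g : hom (tens (one C) (dual X)) (tpow X n) :=
    dualA (hinv (tpowS X n) \c f) \c hinv (runit (dual X))
      \c lunit (dual X) in
  tpow_assoc X n \c tensm (idm (tpow X n)) (hinv (piv X)) \c dualB g.

(* Only meaningful for n >= 1. *)
Definition FSind n X : F :=
  match n with
  | 0%N => 0
  | n'.+1 => ltrace (@FSmap X n')
  end.

End Indicators.

Section Bicharacters.
Variables (R : realType) (A : finZmodType) (chi : A -> A -> R[i]).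

Definition bicharacter : Prop :=
  [/\ forall a b, chi a b != 0,
      forall a b c, chi (a + b) c = chi a c * chi b c
    & forall a b c, chi a (b + c) = chi a b * chi a c].

Definition bichar_symmetric : Prop := forall a b, chi a b = chi b a.

Definition bichar_nondegenerate : Prop :=
  forall a, (forall x, chi x a = 1) -> a = 0.

End Bicharacters.

(* The finite abelian group A is written additively.  The set S of simple
   objects is [option A], where [Some a] stands for a in A and [None] for m. *)
Section TambaraYamagami.
Variables (R : realType) (A : finZmodType) (chi : A -> A -> R[i]) (tau : R).
Local Notation C := R[i].
Local Notation S := (option A).

(* The object (+)_s s^{X s}, given by its multiplicities. *)
Definition ty_obj := S -> nat.
Implicit Types X Y Z : ty_obj.

Definition ty_simple (s : S) : ty_obj := fun t => (t == s)%:R.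

(* The simple summands of X: the pair of s and i is the i-th copy of s in X. *)
Definition summand X : finType := {s : S & 'I_(X s)}.

(* u is a summand of s (x) t *)
Definition fusion (s t u : S) : bool :=
  match s, t, u with
  | Some a, Some b, Some c => c == a + b
  | Some _, None, None => true
  | None, Some _, None => true
  | None, None, Some _ => true
  | _, _, _ => false
  end.

Definition fusion_pairs X Y (u : S) : {pred summand X * summand Y} :=
  [pred ij | fusion (tag ij.1) (tag ij.2) u].

(* As S is multiplicity free, the copies of u in X (x) Y are enumerated by the
   pairs of summands s of X and t of Y with u in s (x) t; [origin] is the
   corresponding pair of summands. *)
Definition ty_tens X Y : ty_obj := fun u => #|@fusion_pairs X Y u|.

Definition origin X Y (q : summand (ty_tens X Y)) : summand X * summand Y :=
  @enum_val _ (@fusion_pairs X Y (tag q)) (tagged q).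

(* A morphism is a family of scalars indexed by the pairs of isomorphic
   summands of X and Y. *)
Definition ty_hom X Y : vectType C :=
  {ffun {pq : summand X * summand Y | tag pq.1 == tag pq.2} -> C^o}.

Definition ty_mk X Y (c : summand X -> summand Y -> C) : ty_hom X Y :=
  [ffun pq => c (val pq).1 (val pq).2].

Definition entry X Y (f : ty_hom X Y) (p : summand X) (q : summand Y) : C :=
  oapp f 0 (insub (p, q)).

Definition ty_id X : ty_hom X X := ty_mk (fun p q => (p == q)%:R).

Definition ty_comp X Y Z (g : ty_hom Y Z) (f : ty_hom X Y) : ty_hom X Z :=
  ty_mk (fun p q => \sum_(z : summand Y) entry g z q * entry f p z).

Definition ty_tensm X X' Y Y' (f : ty_hom X X') (g : ty_hom Y Y') :
    ty_hom (ty_tens X Y) (ty_tens X' Y') :=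
  ty_mk (fun p q => entry f (origin p).1 (origin q).1
                  * entry g (origin p).2 (origin q).2).

Definition ty_one : ty_obj := ty_simple (Some 0).

(* The entry of the associativity constraint (s (x) t) (x) u -> s (x) (t (x) u)
   from the summand w of x (x) u, x in s (x) t, to the summand w of s (x) y,
   y in t (x) u. *)
Definition ty_F (s t u x y w : S) : C :=
  match s, t, u with
  | Some a, None, Some b => chi a b
  | None, Some a, None => if w is Some c then chi a c else 0
  | None, None, None =>
    match x, y with
    | Some b, Some c => tau%:C * (chi b c)^-1
    | _, _ => 0
    end
  | _, _, _ => 1
  end.

Definition ty_assoc X Y Z :
    ty_hom (ty_tens (ty_tens X Y) Z) (ty_tens X (ty_tens Y Z)) :=
  ty_mk (fun p q =>
    let: (xy, k) := origin p in let: (i, j) := origin xy in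
    let: (i', yz) := origin q in let: (j', k') := origin yz in
    if [&& i == i', j == j' & k == k']
    then ty_F (tag i) (tag j) (tag k) (tag xy) (tag yz) (tag p) else 0).

(* The identities, under the identification of the summands of 1 (x) X and of
   X (x) 1 with those of X. *)
Definition ty_lunit X : ty_hom (ty_tens ty_one X) X :=
  ty_mk (fun p q => ((origin p).2 == q)%:R).

Definition ty_runit X : ty_hom (ty_tens X ty_one) X :=
  ty_mk (fun p q => ((origin p).1 == q)%:R).

Definition sdual (s : S) : S := omap -%R s.

Definition ty_dual X : ty_obj := fun s => X (sdual s).

(* i is the n-th copy of s in X and i' is the n-th copy of s^* in X^* *)
Definition dual_summands X (i : summand X) (i' : summand (ty_dual X)) : bool :=
  (tag i' == sdual (tag i)) && (tagged i == tagged i' :> nat).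

Definition ty_coev X : ty_hom ty_one (ty_tens X (ty_dual X)) :=
  ty_mk (fun _ q => (dual_summands (origin q).1 (origin q).2)%:R).

Definition ty_ev X : ty_hom (ty_tens (ty_dual X) X) ty_one :=
  ty_mk (fun p _ =>
    if dual_summands (origin p).2 (origin p).1
    then (if tag (origin p).2 is None then (tau%:C)^-1 else 1) else 0).

Definition ty_piv X : ty_hom X (ty_dual (ty_dual X)) :=
  ty_mk (fun p q =>
    if tagged p == tagged q :> nat
    then (if tag p is None then (Num.sg tau)%:C else 1) else 0).

Definition TY : pivotal_data C :=
  @PivotalData C ty_obj ty_hom ty_id ty_comp ty_one ty_tens ty_tensm
    ty_assoc ty_lunit ty_runit ty_dual ty_coev ty_ev ty_piv.

Definition ty_m : TY := ty_simple None.

End TambaraYamagami.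

Definition legendre (p : nat) (a : 'F_p) : int :=
  if a == 0 then 0 else if [exists x : 'F_p, x ^+ 2 == a] then 1 else -1.

Section ElementaryAbelian.
Variables (R : realType) (p r : nat).
Local Notation V := 'rV['F_p]_r.

(* exp (2 pi i x / p) *)
Definition efp (x : 'F_p) : R[i] :=
  let t : R := 2 * pi * (x : nat)%:R / p%:R in cos t +i* sin t.

(* The bilinear form with matrix B is (v, w) |-> v B w^T. *)
Definition chi_of (B : 'M['F_p]_r) (v w : V) : R[i] :=
  efp ((v *m B *m w^T) 0 0).

Definition form_of (chi : V -> V -> R[i]) : option 'M['F_p]_r :=
  [pick B : 'M['F_p]_r | [forall v, forall w, chi v w == chi_of B v w]].

(* Every bicharacter is chi_of B for a unique B; the default is irrelevant. *)
Definition Dchi (chi : V -> V -> R[i]) : int :=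
  if form_of chi is Some B then legendre (\det B) else 0.

Definition eps_p : R[i] := if (p %% 4 == 1)%N then 1 else 'i.

End ElementaryAbelian.

(* Main.v *)
Require Import Defs.
From mathcomp Require Import all_boot all_order all_algebra.
From mathcomp Require Import fingroup cyclic.
From mathcomp Require Import classical_sets reals exp trigo complex.
From mathcomp Require Import ring lra zify.

Set Implicit Arguments.
Unset Strict Implicit.
Unset Printing Implicit Defensive.

Import Order.TTheory GRing.Theory Num.Theory.
Local Open Scope ring_scope.
Local Open Scope complex_scope.

(** Write T(n) for the n-th tensor power of m.  As m (x) a = m = a (x) m and
    m (x) m is the sum of all a in A, a summand 1 of T(2k) is a path, recording
    the simple summand reached in each of T(1), ..., T(2k).  In the basis of
    Hom(1, T(2k)) given by these summands the map E is a matrix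
    ([entry_FSmap]): the scalars tau and tau^-1 in the duality isomorphisms
    cancel, and besides the pivotal sign sgn(tau) there remains the
    associativity isomorphism T(2k-1) (x) m -> T(2k), whose entries are products
    of entries of the associativity constraint along the two paths
    ([tpow_entryS]).  On the diagonal this product is a weight attached to a
    single path, so that nu_2k(m) is sgn(tau) times the sum of the weights of
    the paths that end in 1 ([FSind_path_sum]).  If Z_k(w) is the sum of the
    weights of the paths of T(2k) that end in w, then
      Z_1(w) = 1   and   Z_(k+1)(w) = sum_a tau chi(a,a)^-1 chi(a,w) Z_k(a)
    ([path_sum0], [path_sumS]).

    Now let chi(v,w) = e(B(v,w)) with B symmetric and non-degenerate
    ([Dchi_form]).  Completing the square turns the recursion into a Gauss sum
    at each step, and by induction ([path_sum_closed])
      Z_k(w) = c_k e((k-1)/(2k) B(w,w))   if p does not divide k,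
      Z_k(w) = d_k [w = 0]                if p divides k,
    where c_(k+1) / c_k = tau G(-(k+1)/(2k)) and G(t) = sum_v e(t B(v,v)); after
    a multiple of p the recursion starts afresh.  Both formulas are read off
    from the values c_k and d_k.

    The Gauss sums over F_p^r reduce to r = 1 by splitting off a non-isotropic
    vector, i.e. by a Schur complement ([quad_sum_det]), and a quadratic sum in
    one variable is a Legendre symbol times g = sum_x e(x^2)
    ([sum_efp_sqr]).  The value g = eps_p sqrt(p), including its sign, comes
    from Gauss' identity for the alternating sum of the Gaussian binomial
    coefficients ([qbin_alt_even]): at a root of unity of order p it writes g as
    a product of factors 2 i sin(2 pi j / p), j odd, whose signs are known
    ([gauss_sum_prod], [gauss_sum_val]). *)

(** * Traces of kernel operators *)

Section Trace.
Variables (F : fieldType) (I : finType).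

(** The trace does not depend on the basis used to define it: on functions
    on I it is the sum of the diagonal entries of the kernel. *)
Lemma ltrace_kernel (K : I -> I -> F) (f : {ffun I -> F^o} -> {ffun I -> F^o}) :
  (forall v i, f v i = \sum_j K i j * v j) -> ltrace f = \sum_i K i i.
Proof.
move=> fE; rewrite /ltrace; set e := vbasis _.
pose dlt j : {ffun I -> F^o} := [ffun i => (i == j)%:R].
have dltE (v : {ffun I -> F^o}) : v = \sum_j v j *: dlt j.
  apply/ffunP => i; rewrite sum_ffunE (bigD1 i) //= !ffunE eqxx big1 ?addr0.
    by rewrite /GRing.scale /= mulr1.
  move=> j /negPf nji; rewrite !ffunE eq_sym nji; exact: mulr0.
transitivity (\sum_(i < \dim {: {ffun I -> F^o}}) \sum_j \sum_l
    K j l * ((e`_i : {ffun I -> F^o}) l * coord e i (dlt j))).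
  apply: eq_bigr => i _; rewrite [f _]dltE linear_sum /=; apply: eq_bigr => j _.
  rewrite linearZ /= fE mulr_suml; apply: eq_bigr => l _.
  by rewrite mulrA.
have orth j l : \sum_(i < \dim {: {ffun I -> F^o}})
    (e`_i : {ffun I -> F^o}) l * coord e i (dlt j) = (l == j)%:R :> F.
  have /(congr1 (fun v : {ffun I -> F^o} => v l)) := coord_vbasis (memvf (dlt j)).
  rewrite -/e ffunE sum_ffunE => ->; apply: eq_bigr => i _.
  by rewrite !ffunE mulrC.
rewrite exchange_big /=; apply: eq_bigr => j _; rewrite exchange_big /=.
under eq_bigr do rewrite -mulr_sumr orth.
by rewrite (bigD1 j) //= eqxx mulr1 big1 ?addr0 // => l /negPf->; rewrite mulr0.
Qed.

End Trace.

(** * Entries of the Tambara-Yamagami morphisms *)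

Section Entries.
Variables (R : realType) (A : finZmodType) (chi : A -> A -> R[i]) (tau : R).
Local Notation C := R[i].
Local Notation S := (option A).
Implicit Types X Y Z W : ty_obj A.

Lemma entry_mk X Y (c : summand X -> summand Y -> C) p q :
  entry (ty_mk c) p q = if tag p == tag q then c p q else 0.
Proof.
rewrite /entry; case: insubP => [u /= -> uE|/= /negPf -> //].
by rewrite /= ffunE (_ : \val u = (p, q)).
Qed.

Lemma entry_neq X Y (f : ty_hom R X Y) p q : tag p != tag q -> entry f p q = 0.
Proof. by move=> npq; rewrite /entry insubN. Qed.

Lemma hom_eqP X Y (f g : ty_hom R X Y) :
  (forall p q, tag p = tag q -> entry f p q = entry g p q) -> f = g.
Proof.
move=> fg; apply/ffunP => -[[p q] pq]; have /eqP tpq := pq.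
by have := fg p q tpq; rewrite /entry /= insubT.
Qed.

Lemma entry_id X p q : entry (ty_id R X) p q = (p == q)%:R.
Proof.
rewrite entry_mk; case: eqVneq => // ntag.
by case: (eqVneq p q) ntag => // ->; rewrite eqxx.
Qed.

Lemma entry_comp X Y Z (g : ty_hom R Y Z) (f : ty_hom R X Y) p q :
  entry (ty_comp g f) p q = \sum_z entry g z q * entry f p z.
Proof.
rewrite entry_mk; case: eqVneq => // npq; rewrite big1 // => z _.
have [zq|/entry_neq-> ] := eqVneq (tag z) (tag q); last by rewrite mul0r.
by rewrite (entry_neq f) ?mulr0 // zq.
Qed.

Lemma entry_tensm X X' Y Y' (f : ty_hom R X X') (g : ty_hom R Y Y') p q :
  entry (ty_tensm f g) p q = if tag p == tag q then
    entry f (origin p).1 (origin q).1 * entry g (origin p).2 (origin q).2 else 0.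
Proof. exact: entry_mk. Qed.

Lemma ty_comp1f X Y (f : ty_hom R X Y) : ty_comp (ty_id R Y) f = f.
Proof.
apply: hom_eqP => p q _; rewrite entry_comp (bigD1 q) //= entry_id eqxx mul1r.
by rewrite big1 ?addr0 // => z /negPf nzq; rewrite entry_id nzq mul0r.
Qed.

Lemma ty_compf1 X Y (f : ty_hom R X Y) : ty_comp f (ty_id R X) = f.
Proof.
apply: hom_eqP => p q _; rewrite entry_comp (bigD1 p) //= entry_id eqxx mulr1.
by rewrite big1 ?addr0 // => z nzp; rewrite entry_id eq_sym (negPf nzp) mulr0.
Qed.

Lemma ty_compA X Y Z W (h : ty_hom R Z W) (g : ty_hom R Y Z) (f : ty_hom R X Y) :
  ty_comp h (ty_comp g f) = ty_comp (ty_comp h g) f.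
Proof.
apply: hom_eqP => p q _; rewrite !entry_comp.
under eq_bigr do rewrite entry_comp mulr_sumr.
rewrite exchange_big /=; apply: eq_bigr => z _.
by rewrite entry_comp mulr_suml; apply: eq_bigr => w _; rewrite mulrA.
Qed.

Local Notation TY := (TY chi tau).

(** A two-sided inverse is unique, so it is the one that [hinv] picks. *)
Lemma hinv_uniq (X Y : TY) (f : Defs.hom X Y) (g : Defs.hom Y X) :
  Defs.comp g f = idm X -> Defs.comp f g = idm Y -> hinv f = g.
Proof.
move=> gf fg; rewrite /hinv; apply: xget_unique; first by split.
move=> h [hf _]; rewrite /= in h hf gf fg *.
by rewrite -[h]ty_compf1 -fg ty_compA hf ty_comp1f.
Qed.

Lemma origin_fusion X Y (q : summand (ty_tens X Y)) :
  fusion (tag (origin q).1) (tag (origin q).2) (tag q).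
Proof. by case: q => u i; have := enum_valP i. Qed.

Lemma summand_tens_inj X Y (q q' : summand (ty_tens X Y)) :
  tag q = tag q' -> origin q = origin q' -> q = q'.
Proof.
case: q q' => u i [u' i'] /= uu'; case: u' / uu' i' => i'.
by rewrite /origin /= => /enum_val_inj ->.
Qed.

Lemma summand_tens_exists X Y i j u : fusion (tag i) (tag j) u ->
  exists q : summand (ty_tens X Y), tag q = u /\ origin q = (i, j).
Proof.
move=> ij; have ijin : (i, j) \in @fusion_pairs A X Y u by [].
exists (existT (fun s => 'I_(ty_tens X Y s)) u (enum_rank_in ijin (i, j))); split=> //.
by rewrite /origin /= enum_rankK_in.
Qed.

(** The summands of X (x) Y are the triples of a summand i of X, a summand j of
    Y and a simple summand u of their tensor product. *)
Lemma sum_summand_tens X Y (F : S -> summand X -> summand Y -> C) :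
  \sum_(q : summand (ty_tens X Y)) F (tag q) (origin q).1 (origin q).2 =
  \sum_i \sum_j \sum_(u | fusion (tag i) (tag j) u) F u i j.
Proof.
under [RHS]eq_bigr => i _ do rewrite pair_big_dep /=.
rewrite pair_big_dep /=.
pose h (q : summand (ty_tens X Y)) := ((origin q).1, ((origin q).2, tag q)).
have h_inj : injective h.
  move=> q q' [] o1 o2 t; apply: summand_tens_inj => //.
  by case: (origin q) (origin q') o1 o2 => a b [a' b'] /= -> ->.
rewrite (eq_bigl [in h @: setT]) => [|[i [j u]] /=].
  rewrite big_imset /= => [|? ? _ _]; last exact: h_inj.
  by apply: eq_bigl => q; rewrite in_setT.
apply/idP/imsetP => [/summand_tens_exists[q [<- qo]]|[q _ [-> -> ->]]].
  by exists q; rewrite ?in_setT // /h qo.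
exact: origin_fusion.
Qed.

(** X is isomorphic to the simple object s. *)
Definition is_copy (s : S) X : Prop :=
  exists i0 : summand X, tag i0 = s /\ forall i, i = i0.

(** Every simple object occurs at most once in X. *)
Definition mult_free X : Prop :=
  forall i j : summand X, tag i = tag j -> i = j.

(** Between multiplicity-free objects with the same simple summands, a morphism
    is an isomorphism as soon as its diagonal entries are nonzero. *)
Lemma hinv_mult_free (X Y : TY) (f : Defs.hom X Y) (c : S -> C) :
  mult_free X -> mult_free Y ->
  (forall p : summand X, exists q : summand Y, tag q = tag p) ->
  (forall q : summand Y, exists p : summand X, tag p = tag q) ->
  (forall s, c s != 0) ->
  (forall p q, entry f p q = if tag p == tag q then c (tag p) else 0) ->
  forall q p, entry (hinv f) q p = if tag q == tag p then (c (tag q))^-1 else 0.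
Proof.
move=> Xi Yi XY YX c0 fE.
rewrite (@hinv_uniq _ _ f (ty_mk (fun q p => (c (tag q))^-1))); 
  first by move=> q p; rewrite entry_mk.
  apply: hom_eqP => p p' _; rewrite entry_comp entry_id.
  have [q qp] := XY p; rewrite (bigD1 q) //= big1 => [|z nzq].
    rewrite entry_mk fE qp eqxx addr0.
    case: (eqVneq p) => [->|npp']; first by rewrite eqxx mulVf.
    by rewrite ifN ?mul0r //; apply: contraNneq npp' => /Xi ->.
  rewrite fE ifN ?mulr0 //; apply: contraNneq nzq; rewrite -qp => /Yi -> //.
apply: hom_eqP => p p' _; rewrite entry_comp entry_id.
have [q qp] := YX p; rewrite (bigD1 q) //= big1 => [|z nzq].
  rewrite entry_mk fE qp eqxx addr0.
  case: (eqVneq p) => [->|npp']; first by rewrite eqxx divff.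
  by rewrite ifN ?mul0r //; apply: contraNneq npp' => /Yi ->.
rewrite entry_mk ifN ?mulr0 //; apply: contraNneq nzq; rewrite -qp => /Xi -> //.
Qed.

End Entries.

(** * Simple and multiplicity-free objects *)

Section Singletons.
Variables (A : finZmodType).
Local Notation S := (option A).
Implicit Types X Y Z W : ty_obj A.

Lemma mult_is_copy s X : X s = 1%N -> (forall t, t != s -> X t = 0%N) -> is_copy s X.
Proof.
move=> Xs Xt; have lt0 : (0 < X s)%N by rewrite Xs.
exists (existT (fun s => 'I_(X s)) s (Ordinal lt0)); split=> // -[t i].
have ts : t = s.
  apply/eqP; apply: contraT => /Xt Xt0; have := ltn_ord i.
  by move: (nat_of_ord i) => k; rewrite Xt0.
case: s / ts Xs lt0 Xt i => Xs lt0 Xt i; congr existT; apply/val_inj => /=.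
by move: (ltn_ord i); move: (nat_of_ord i) => k; rewrite Xs; case: k.
Qed.

Lemma copy_simple (s : S) : is_copy s (ty_simple s).
Proof. by apply: mult_is_copy => [|t /negPf]; rewrite /ty_simple ?eqxx // => ->. Qed.

Lemma copy_dual s X : is_copy s X -> is_copy (sdual s) (ty_dual X).
Proof.
have sK : involutive (@sdual A) by case=> //= a; rewrite opprK.
move=> [i0 [is0 i0U]]; apply: mult_is_copy => [|t nts].
  rewrite /ty_dual sK -is0.
  case: i0 i0U {is0} => t i i0U /=; apply/eqP.
  have -> : X t = #|'I_(X t)| by rewrite card_ord.
  apply/fintype1P; exists i => j.
  have := i0U (existT _ t j) => /eqP.
  by rewrite -tag_eqE /tag_eq /= eqxx tagged_asE => /eqP.
apply/eqP; rewrite -leqn0 leqNgt /ty_dual; apply: contra nts => lt0.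
have := i0U (existT (fun s => 'I_(X s)) (sdual t) (Ordinal lt0)).
by move/(congr1 (@tag _ _)); rewrite /= is0 => <-; rewrite sK.
Qed.

Lemma copy_tag s X (i : summand X) : is_copy s X -> tag i = s.
Proof. by case=> i0 [<- i0U]; rewrite (i0U i). Qed.

Lemma copy_eq s X (i j : summand X) : is_copy s X -> i = j.
Proof. by case=> i0 [_ iE]; rewrite (iE i) (iE j). Qed.

Lemma copy_mult_free s X : is_copy s X -> mult_free X.
Proof. by move=> Xs i j _; apply: copy_eq Xs. Qed.

Lemma copy_tensl s X Y : is_copy (Some 0) X -> is_copy s Y -> is_copy s (ty_tens X Y).
Proof.
move=> X1 Ys; have [i [iE _]] := X1; have [j [jE _]] := Ys.
have [|q [qs qo]] := @summand_tens_exists _ X Y i j s.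
  by rewrite iE jE; case: (s) => //= a; rewrite add0r.
exists q; split=> // q'; apply: summand_tens_inj.
  have := origin_fusion q'; rewrite (copy_tag _ X1) (copy_tag _ Ys) qs.
  by case: (s) (tag q') => [a|] [b|] //= /eqP ->; rewrite add0r.
by rewrite qo; case: (origin q') => i' j'; rewrite (copy_eq i' i X1) (copy_eq j' j Ys).
Qed.

Lemma copy_tensr s X Y : is_copy s X -> is_copy (Some 0) Y -> is_copy s (ty_tens X Y).
Proof.
move=> Xs Y1; have [i [iE _]] := Xs; have [j [jE _]] := Y1.
have [|q [qs qo]] := @summand_tens_exists _ X Y i j s.
  by rewrite iE jE; case: (s) => //= a; rewrite addr0.
exists q; split=> // q'; apply: summand_tens_inj.
  have := origin_fusion q'; rewrite (copy_tag _ Xs) (copy_tag _ Y1) qs.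
  by case: (s) (tag q') => [a|] [b|] //= /eqP ->; rewrite addr0.
by rewrite qo; case: (origin q') => i' j'; rewrite (copy_eq i' i Xs) (copy_eq j' j Y1).
Qed.

Lemma mult_free_tens s t X Y : is_copy s X -> is_copy t Y -> mult_free (ty_tens X Y).
Proof.
move=> Xs Yt q q' tq; apply: summand_tens_inj => //.
case: (origin q) (origin q') => i j [i' j'].
by rewrite (copy_eq i i' Xs) (copy_eq j j' Yt).
Qed.

Lemma tag_tensl X Y (q : summand (ty_tens X Y)) :
  is_copy (Some 0) X -> tag q = tag (origin q).2.
Proof.
move=> X1; have := origin_fusion q; rewrite (copy_tag _ X1).
by case: (tag q) (tag _) => [a|] [b|] //= /eqP ->; rewrite add0r.
Qed.

Lemma mult_free_tensl X Y : is_copy (Some 0) X -> mult_free Y -> mult_free (ty_tens X Y).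
Proof.
move=> X1 Ym q q' tq; apply: summand_tens_inj => //.
have : (origin q).2 = (origin q').2 by apply: Ym; rewrite -!tag_tensl.
case: (origin q) (origin q') => i j [i' j'] /= ->.
by rewrite (copy_eq i i' X1).
Qed.

End Singletons.

Section BigCopy.
Variables (R : realType) (A : finZmodType).
Local Notation C := R[i].
Local Notation S := (option A).
Implicit Types X Y Z W : ty_obj A.

Lemma big_copy s X (F : summand X -> C) i : is_copy s X -> \sum_j F j = F i.
Proof.
move=> Xs; rewrite (bigD1 i) //= big1 ?addr0 // => j.
by rewrite (copy_eq j i Xs) eqxx.
Qed.

(** Sums over the simple summands of s (x) t, one case of the fusion rules at a
    time; in the names, m stands for the object m and a for an element of A. *)
Lemma big_fusion_mm (F : S -> C) : \sum_(u | fusion None None u) F u = \sum_(c : A) F (Some c).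
Proof.
rewrite (reindex_omap Some id) => [|[a|]//=].
by apply: eq_bigl => a; rewrite /= eqxx.
Qed.

Lemma big_fusion_am a (F : S -> C) : \sum_(u | fusion (Some a) None u) F u = F None.
Proof. by apply: big_pred1 => -[]. Qed.

Lemma big_fusion_ma a (F : S -> C) : \sum_(u | fusion None (Some a) u) F u = F None.
Proof. by apply: big_pred1 => -[]. Qed.

(** The summands of (X (x) Y) (x) Z, with X = Y = m and Z a multiple of m, are
    the pairs of an element of A and a summand of Z; the next two lemmas
    describe X (x) (Y (x) Z) in the same way. *)
Lemma big_tens_mmZ X Y Z (F : S -> summand Z -> C) :
  is_copy None X -> is_copy None Y -> (forall z : summand Z, tag z = None) ->
  \sum_(q : summand (ty_tens (ty_tens X Y) Z)) F (tag (origin q).1) (origin q).2 =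
  \sum_z \sum_b F (Some b) z.
Proof.
move=> Xm Ym Zm; have [i [im _]] := Xm; have [j [jm _]] := Ym.
rewrite (sum_summand_tens (fun _ xy z => F (tag xy) z)) exchange_big /=.
apply: eq_bigr => z _; rewrite Zm.
rewrite (sum_summand_tens (fun u _ _ => \sum_(v | fusion u None v) F u z)).
rewrite (big_copy _ i Xm) (big_copy _ j Ym) im jm big_fusion_mm.
by apply: eq_bigr => b _; rewrite big_fusion_am.
Qed.

Lemma big_tens_mYZ X Y (F : summand Y -> C) :
  is_copy None X -> (forall y : summand Y, tag y != None) ->
  \sum_(q : summand (ty_tens X Y)) F (origin q).2 = \sum_y F y.
Proof.
move=> Xm YA; have [i [im _]] := Xm.
rewrite (sum_summand_tens (fun _ _ y => F y)) (big_copy _ i Xm) im /=.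
apply: eq_bigr => y _; case: (tag y) (YA y) => // a _.
exact: big_fusion_ma.
Qed.

Lemma big_tens_mZ Y Z (F : S -> summand Z -> C) :
  is_copy None Y -> (forall z : summand Z, tag z = None) ->
  \sum_(q : summand (ty_tens Y Z)) F (tag q) (origin q).2 = \sum_z \sum_b F (Some b) z.
Proof.
move=> Ym Zm; have [j [jm _]] := Ym.
rewrite (sum_summand_tens (fun u _ z => F u z)) (big_copy _ j Ym) jm.
by apply: eq_bigr => z _; rewrite Zm big_fusion_mm.
Qed.

Lemma tag_tens_mm X Y (q : summand (ty_tens X Y)) :
  tag (origin q).1 = None -> tag (origin q).2 = None -> exists a, tag q = Some a.
Proof.
have := origin_fusion q.
by case: (tag _) (tag _) (tag q) => [a|] [b|] [c|] //=; exists c.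
Qed.

End BigCopy.

(** * The inverse associativity constraint *)

Section Orthogonality.
Variables (R : realType) (A : finZmodType) (chi : A -> A -> R[i]).
Hypotheses (chiB : bicharacter chi) (chiS : bichar_symmetric chi)
  (chiN : bichar_nondegenerate chi).

Lemma bichar0l a : chi 0 a = 1.
Proof.
have [nz Dl _] := chiB; have := Dl 0 0 a; rewrite addr0 => /eqP.
by rewrite -{1}[chi 0 a]mulr1 (inj_eq (mulfI (nz 0 a))) => /eqP.
Qed.

Lemma bichar0r a : chi a 0 = 1.
Proof. by rewrite chiS bichar0l. Qed.

Lemma bicharNl a b : chi (- a) b = (chi a b)^-1.
Proof.
have [nz Dl _] := chiB; apply: (mulfI (nz a b)).
by rewrite -Dl subrr bichar0l divff.
Qed.

(** Orthogonality of characters: by non-degeneracy some chi x a differs from 1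
    when a != 0, and translating by x multiplies the sum by it. *)
Lemma bichar_sum a : \sum_c chi a c = if a == 0 then #|A|%:R else 0.
Proof.
case: eqVneq => [->|an0].
  by under eq_bigr do rewrite bichar0l; rewrite sumr_const.
have [nz _ Dr] := chiB.
have [x xa] : exists x, chi x a != 1.
  apply/existsP; apply: contraR an0; rewrite negb_exists => /forallP xa.
  by apply/eqP; apply: chiN => x; apply/eqP; rewrite -[_ == _]negbK.
have xa1 : 1 - chi x a != 0 by rewrite subr_eq0 eq_sym.
apply: (mulIf xa1); rewrite mul0r mulrBr mulr1 mulr_suml; apply/eqP; rewrite subr_eq0.
rewrite (reindex_inj (addIr x)) /=; apply/eqP; apply: eq_bigr => c _.
by rewrite Dr [chi x a]chiS.
Qed.

End Orthogonality.

Section DualityMaps.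
Variables (R : realType) (A : finZmodType) (chi : A -> A -> R[i]) (tau : R).
Hypotheses (chiB : bicharacter chi) (chiS : bichar_symmetric chi)
  (chiN : bichar_nondegenerate chi).
Hypothesis (tau_sqr : tau ^+ 2 = (#|A|%:R)^-1).
Local Notation C := R[i].
Local Notation S := (option A).
Local Notation TY := (TY chi tau).
Local Notation m := (ty_m chi tau).
Implicit Types X Y Z W : TY.

Lemma tau_neq0 : tau%:C != 0 :> C.
Proof.
have : tau != 0.
  apply: contra_eq_neq tau_sqr => ->; rewrite expr0n /= eq_sym invr_eq0 pnatr_eq0.
  by rewrite -lt0n; apply/card_gt0P; exists 0.
by apply: contraNneq => /complexI ->.
Qed.

Lemma tau_sqrC : tau%:C ^+ 2 * #|A|%:R = 1 :> C.
Proof.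
rewrite -rmorphXn /= tau_sqr fmorphV rmorph_nat mulVf // pnatr_eq0.
by rewrite -lt0n; apply/card_gt0P; exists 0.
Qed.

(** chi on pairs of simple objects, extended by 1 when one of them is m. *)
Definition ochi (x y : S) : C :=
  if x is Some a then if y is Some b then chi a b else 1 else 1.

Section AssocInv.
Variables X Y Z : TY.
Hypotheses (Xm : is_copy None X) (Ym : is_copy None Y)
  (Zm : forall z : summand Z, tag z = None).

Let tagL (p : summand (ty_tens (ty_tens X Y) Z)) :
  (exists b, tag (origin p).1 = Some b) /\ tag p = None.
Proof.
have [b bE] : exists a, tag (origin p).1 = Some a.
  by apply: tag_tens_mm; [apply: copy_tag Xm | apply: copy_tag Ym].
split; first by exists b.
by have := origin_fusion p; rewrite bE Zm; case: (tag p).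
Qed.

Let tagR (p : summand (ty_tens X (ty_tens Y Z))) :
  (exists b, tag (origin p).2 = Some b) /\ tag p = None.
Proof.
have [b bE] : exists a, tag (origin p).2 = Some a.
  by apply: tag_tens_mm; [apply: copy_tag Ym | apply: Zm].
split; first by exists b.
by have := origin_fusion p; rewrite bE (copy_tag _ Xm); case: (tag p).
Qed.

Let eqL (p p' : summand (ty_tens (ty_tens X Y) Z)) :
  (p == p') = (tag (origin p).1 == tag (origin p').1) && ((origin p).2 == (origin p').2).
Proof.
apply/eqP/andP => [->|[/eqP t /eqP o]] //; apply: summand_tens_inj.
  by rewrite (tagL p).2 (tagL p').2.
have : (origin p).1 = (origin p').1 by apply: (mult_free_tens Xm Ym).
by case: (origin p) (origin p') o => i j [i' j'] /= -> ->.
Qed.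

Let eqR (p p' : summand (ty_tens X (ty_tens Y Z))) :
  (p == p') = (tag (origin p).2 == tag (origin p').2)
    && ((origin (origin p).2).2 == (origin (origin p').2).2).
Proof.
apply/eqP/andP => [->|[/eqP t /eqP o]] //; apply: summand_tens_inj.
  by rewrite (tagR p).2 (tagR p').2.
have : (origin p).2 = (origin p').2.
  apply: summand_tens_inj => //.
  case: (origin (origin p).2) (origin (origin p').2) o => i j [i' j'] /= ->.
  by rewrite (copy_eq i i' Ym).
by case: (origin p) (origin p') => i j [i' j'] /= ->; rewrite (copy_eq i i' Xm).
Qed.

Lemma entry_assoc_mmZ p q : entry (assoc X Y Z) p q =
  if (origin p).2 == (origin (origin q).2).2
  then tau%:C * (ochi (tag (origin p).1) (tag (origin q).2))^-1 else 0.
Proof.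
rewrite entry_mk (tagL p).2 (tagR q).2 eqxx.
have [[b bE] _] := tagL p; have [[c cE] _] := tagR q.
case op: (origin p) bE => [xy k] /= bE; case oxy: (origin xy) => [i j].
case oq: (origin q) cE => [i' yz] /= cE; case oyz: (origin yz) => [j' k'].
rewrite (copy_eq i i' Xm) (copy_eq j j' Ym) !eqxx /=; case: eqP => // _.
by rewrite (copy_tag _ Xm) (copy_tag _ Ym) Zm bE cE.
Qed.

(** As chi is non-degenerate and tau^2 = 1 / |A|, the matrix tau chi(a,b)^-1 is
    inverse to tau chi(a,b), by orthogonality of characters. *)
Lemma entry_hinv_assoc_mmZ q p : entry (hinv (assoc X Y Z)) q p =
  if (origin p).2 == (origin (origin q).2).2
  then tau%:C * ochi (tag (origin p).1) (tag (origin q).2) else 0.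
Proof.
have [nz Dl Dr] := chiB.
set h : ty_hom R (ty_tens X (ty_tens Y Z)) (ty_tens (ty_tens X Y) Z) :=
  ty_mk (fun q p => if (origin p).2 == (origin (origin q).2).2
  then tau%:C * ochi (tag (origin p).1) (tag (origin q).2) else 0).
have hE q' p' : entry h q' p' = if (origin p').2 == (origin (origin q').2).2
  then tau%:C * ochi (tag (origin p').1) (tag (origin q').2) else 0.
  by rewrite entry_mk (tagL p').2 (tagR q').2.
rewrite (@hinv_uniq _ _ chi tau _ _ _ h) ?hE //; apply: hom_eqP => {p q} p p' _.
  rewrite entry_comp entry_id eqL.
  under eq_bigr do rewrite hE entry_assoc_mmZ.
  have [[b bE] _] := tagL p; have [[b' bE'] _] := tagL p'.
  rewrite bE bE'.
  rewrite (big_tens_mYZ (fun y => (if (origin p').2 == (origin y).2 then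
    tau%:C * ochi (Some b') (tag y) else 0) *
    (if (origin p).2 == (origin y).2 then tau%:C * (ochi (Some b) (tag y))^-1 else 0)) Xm);
    last first.
    move=> y; have [a ->] // : exists a, tag y = Some a.
    by apply: tag_tens_mm; [apply: copy_tag Ym | apply: Zm].
  rewrite (big_tens_mZ (fun u y => (if (origin p').2 == y then
    tau%:C * ochi (Some b') u else 0) *
    (if (origin p).2 == y then tau%:C * (ochi (Some b) u)^-1 else 0)) Ym Zm) /=.
  rewrite (bigD1 (origin p).2) //= [X in _ + X]big1 ?addr0 => [|z /negPf nz']; last first.
    by rewrite [(origin p).2 == z]eq_sym nz'; rewrite big1 // => *; rewrite mulr0.
  rewrite eqxx [Some b == _]eq_sym [(origin p).2 == _]eq_sym.
  case: eqP => _; last by rewrite andbF big1 // => *; rewrite mul0r.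
  under eq_bigr => c _ do rewrite mulrACA -expr2 -bicharNl // -Dl.
  rewrite -mulr_sumr bichar_sum // subr_eq0 andbT.
  have -> : (Some b' == Some b) = (b' == b) by [].
  by case: eqP; rewrite ?mulr0 // tau_sqrC.
rewrite entry_comp entry_id eqR.
under eq_bigr do rewrite hE entry_assoc_mmZ.
have [[b bE] _] := tagR p; have [[b' bE'] _] := tagR p'.
rewrite bE bE'.
rewrite (big_tens_mmZ (fun u z => (if z == (origin (origin p').2).2 then
    tau%:C * (ochi u (Some b'))^-1 else 0) *
    (if z == (origin (origin p).2).2 then tau%:C * (ochi u (Some b)) else 0)) Xm Ym Zm) /=.
rewrite (bigD1 (origin (origin p).2).2) //= [X in _ + X]big1 ?addr0
  => [|z /negPf nz']; last first.
  by rewrite nz'; rewrite big1 // => *; rewrite mulr0.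
rewrite eqxx.
case: eqP => _; last by rewrite andbF big1 // => *; rewrite mul0r.
rewrite andbT.
have -> : (Some b == Some b') = (b == b') by [].
transitivity (\sum_c tau%:C ^+ 2 * chi (b - b') c).
  apply: eq_bigr => c _; rewrite Dl bicharNl // [chi b c]chiS [chi b' c]chiS.
  by rewrite mulrACA expr2 [chi c b * _]mulrC.
by rewrite -mulr_sumr bichar_sum // subr_eq0; case: eqP; rewrite ?mulr0 // tau_sqrC.
Qed.

End AssocInv.
End DualityMaps.

(** * The map E in coordinates *)

Section FSmapEntries.
Variables (R : realType) (A : finZmodType) (chi : A -> A -> R[i]) (tau : R).
Hypotheses (chiB : bicharacter chi) (chiS : bichar_symmetric chi)
  (chiN : bichar_nondegenerate chi).
Hypothesis (tau_sqr : tau ^+ 2 = (#|A|%:R)^-1).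
Local Notation C := R[i].
Local Notation TY := (TY chi tau).
Local Notation m := (ty_m chi tau).
Local Notation hom := (@Defs.hom _ TY).
Local Notation one := (Defs.one TY).
Implicit Types X Y Z W : TY.

(** The objects m, m^*, m^** have the same unique simple summand, but they are
    not convertible. *)
Lemma copy_m : is_copy None m. Proof. exact: copy_simple. Qed.
Lemma copy_m' : is_copy None (dual m).
Proof. exact: (@copy_dual _ None _ copy_m). Qed.
Lemma copy_m'' : is_copy None (dual (dual m)).
Proof. exact: (@copy_dual _ None _ copy_m'). Qed.
Lemma copy_one : is_copy (Some 0) one. Proof. exact: copy_simple. Qed.

Lemma hinv_idm X : hinv (idm X) = idm X.
Proof. by apply: hinv_uniq; rewrite /= ty_comp1f. Qed.

Lemma entry_runit X p q : mult_free X -> entry (runit X) p q = (tag p == tag q)%:R.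
Proof.
move=> Xf; rewrite entry_mk; case: eqVneq => // pq.
rewrite (_ : (origin p).1 = q) ?eqxx //; apply: Xf.
have := origin_fusion p; rewrite (copy_tag (origin p).2 copy_one) pq.
by case: (tag q) (tag _) => [a|] [b|] //= /eqP ->; rewrite addr0.
Qed.

Lemma entry_hinv_runit s X p q :
  is_copy s X -> entry (hinv (runit X)) p q = 1.
Proof.
move=> Xs.
have X1s : is_copy s (tens X one) by apply: copy_tensr Xs copy_one.
rewrite (@hinv_mult_free _ _ _ _ _ _ _ (fun=> 1)).
- by rewrite (copy_tag p Xs) (copy_tag q X1s) eqxx invr1.
- exact: (copy_mult_free X1s).
- exact: (copy_mult_free Xs).
- by move=> p'; exists p; rewrite (copy_tag p' X1s) (copy_tag p Xs).
- by move=> q'; exists q; rewrite (copy_tag q' Xs) (copy_tag q X1s).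
- by move=> _; apply: oner_neq0.
move=> p' q'; rewrite entry_runit; last exact: (copy_mult_free Xs).
by case: eqP.
Qed.

Lemma entry_lunit X p q :
  entry (lunit X) p q = ((origin p).2 == q)%:R.
Proof.
rewrite entry_mk (tag_tensl _ copy_one); case: eqVneq => // npq.
by case: (eqVneq (origin p).2 q) npq => // ->; rewrite eqxx.
Qed.

Lemma tagged_copy s X (i : summand X) : is_copy s X -> nat_of_ord (tagged i) = 0%N.
Proof.
move=> Xs; have lt0 : (0 < X (tag i))%N := leq_ltn_trans (leq0n _) (ltn_ord (tagged i)).
by rewrite (copy_eq i (existT (fun s => 'I_(X s)) (tag i) (Ordinal lt0)) Xs).
Qed.

Lemma dual_summands_copy X (i : summand X) (i' : summand (ty_dual X)) :
  is_copy None X -> dual_summands i i'.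
Proof.
move=> Xm; have Xm' := copy_dual Xm.
rewrite /dual_summands (tagged_copy i Xm) (tagged_copy i' Xm').
by rewrite (copy_tag i Xm) (copy_tag i' Xm').
Qed.

Lemma entry_ev (p : summand (tens (dual m) m)) (q : summand one) :
  entry (ev m) p q = if tag p == Some 0 then tau%:C^-1 else 0.
Proof.
rewrite entry_mk (copy_tag q copy_one) (dual_summands_copy _ _ copy_m).
by rewrite (copy_tag (origin p).2 copy_m).
Qed.

Lemma entry_coev (p : summand one) (q : summand (tens (dual m) (dual (dual m)))) :
  entry (coev (dual m)) p q = (tag q == Some 0)%:R.
Proof.
rewrite entry_mk (copy_tag p copy_one) eq_sym (dual_summands_copy _ _ copy_m').
by case: eqP.
Qed.

Section DualA.
Variable Y : TY.
Hypothesis Ym : forall y : summand Y, tag y = None.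

(** The entry tau of the inverse associativity isomorphism cancels against the
    factor tau^-1 of the evaluation. *)
Lemma entry_dualA (f : hom one (tens m Y)) p y o : entry (dualA f) p y =
  \sum_(q : summand (tens m Y) | (origin q).2 == y) entry f o q.
Proof.
have fE q : tag q != Some 0 -> entry f o q = 0.
  by move=> nq; apply: entry_neq; rewrite (copy_tag o copy_one) eq_sym.
have tagp : tag p = None by apply: copy_tag (copy_tensr copy_m' copy_one).
have idfE (w : summand (tens (dual m) (tens m Y))) :
    entry (tensm (idm (dual m)) f) p w = entry f o (origin w).2.
  rewrite entry_tensm entry_id (copy_eq (origin p).1 (origin w).1 copy_m') eqxx mul1r.
  rewrite (copy_eq (origin p).2 o copy_one); case: eqP => // /eqP.
  rewrite tagp => tagw; rewrite fE //; apply: contra_neq tagw => w0.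
  have := origin_fusion w; rewrite w0 (copy_tag _ copy_m').
  by case: (tag w).
have evE (v : summand (tens (tens (dual m) m) Y)) (z : summand (tens one Y)) :
    entry (tensm (ev m) (idm Y)) v z =
    if (tag (origin v).1 == Some 0) && ((origin v).2 == (origin z).2) then tau%:C^-1 else 0.
  rewrite entry_tensm entry_ev entry_id.
  rewrite (tag_tensl z copy_one) Ym.
  have -> : tag v == None.
    have [||b bE] := @tag_tens_mm _ _ _ (origin v).1.
    - exact: copy_tag copy_m'.
    - exact: copy_tag copy_m.
    by have := origin_fusion v; rewrite bE Ym; case: (tag v).
  by case: (tag _ == _); case: (_ == _); rewrite /= ?mulr1 ?mulr0 ?mul0r.
rewrite !entry_comp.
transitivity (\sum_(w : summand (tens (dual m) (tens m Y)) | (origin (origin w).2).2 == y)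
     entry f o (origin w).2).
  under eq_bigr => w _ do rewrite idfE.
  rewrite [RHS]big_mkcond /=; apply: eq_bigr => w _.
  rewrite entry_comp.
  under eq_bigr do rewrite entry_comp
    (entry_hinv_assoc_mmZ chiB chiS chiN tau_sqr copy_m' copy_m Ym).
  have [|c0] := eqVneq (tag (origin w).2) (Some 0); last by rewrite fE // mulr0 if_same.
  move=> c0; rewrite c0.
  have ochi0 x : ochi chi x (Some 0) = 1.
    by case: x => //= x; rewrite bichar0r.
  under eq_bigr => v _ do rewrite ochi0 mulr1.
  have zE v : \sum_z entry (lunit Y) z y * entry (tensm (ev m) (idm Y)) v z =
    if (tag (origin v).1 == Some 0) && ((origin v).2 == y) then tau%:C^-1 else 0.
    have [z [zt zo]] : exists z : summand (tens one Y), tag z = None /\ origin z = (o, y).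
      by apply: summand_tens_exists; rewrite (copy_tag o copy_one) Ym.
    rewrite (bigD1 z) //= evE entry_lunit zo /= eqxx mul1r big1 ?addr0 // => z' nz'.
    rewrite entry_lunit; case: eqP => [zy|]; last by rewrite mul0r.
    case/eqP: nz'; apply: summand_tens_inj.
      by rewrite zt (tag_tensl _ copy_one) zy Ym.
    rewrite zo -zy; case: (origin z') => i j /=.
    by rewrite (copy_eq i o copy_one).
  under eq_bigr => v _ do rewrite zE.
  rewrite (big_tens_mmZ (fun u z => (if (u == Some 0) && (z == y) then tau%:C^-1 else 0) *
    (if z == (origin (origin w).2).2 then tau%:C else 0)) copy_m' copy_m Ym).
  rewrite (bigD1 y) //= [X in _ + X]big1 ?addr0 => [|z /negPf ->]; last first.
    by rewrite big1 // => b _; rewrite andbF mul0r.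
  rewrite (bigD1 0) //= !eqxx [X in _ + X]big1 ?addr0 => [|b /negPf nb]; last first.
    by rewrite (_ : Some b == Some 0 = false) ?mul0r.
  rewrite eq_sym; case: eqP => _; last by rewrite mulr0 mul0r.
  by rewrite mulVf ?mul1r // (tau_neq0 tau_sqr).
rewrite big_mkcond [RHS]big_mkcond /=.
apply: (big_tens_mYZ (fun q => if (origin q).2 == y then entry f o q else 0) copy_m').
move=> q; have [||a ->] // := @tag_tens_mm _ _ _ q; first exact: copy_tag copy_m.
Qed.

End DualA.

Lemma entry_comp_copy X Z (h : hom X Z) W (u : hom W X) p q i s :
  is_copy s X -> entry (Defs.comp h u) p q = entry h i q * entry u p i.
Proof. by move=> Xs; rewrite entry_comp (big_copy _ i Xs). Qed.

(** All the objects through which the coevaluation passes are multiplicity-free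
    and the associativity constraint involved is trivial. *)
Lemma entry_dualB Y (g : hom (tens one (dual m)) Y) o (v : summand (tens Y (dual (dual m)))) i :
  tag v = Some 0 -> entry (dualB g) o v = entry g i (origin v).1.
Proof.
move=> v0; rewrite /dualB.
have c1m' : is_copy None (tens one (dual m)) by apply: copy_tensl copy_one copy_m'.
have c11 : is_copy (Some 0) (tens one one) by apply: copy_tensl copy_one copy_one.
have mfL : mult_free (tens (tens one (dual m)) (dual (dual m))).
  exact: mult_free_tens c1m' copy_m''.
have mfR : mult_free (tens one (tens (dual m) (dual (dual m)))).
  exact: mult_free_tensl copy_one (mult_free_tens copy_m' copy_m'').
have [j' [j't _]] := copy_m'; have [j'' [j''t _]] := copy_m''; have [o1 [o1t _]] := copy_one.
have [o2 _] := c11; have [i1 [i1t _]] := c1m'.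
have exL a : exists q : summand (tens (tens one (dual m)) (dual (dual m))), tag q = Some a.
  have [|q [qt _]] := @summand_tens_exists _ (tens one (dual m)) (dual (dual m)) i1 j'' (Some a).
    by rewrite i1t j''t.
  by exists q.
have exR a : exists q : summand (tens one (tens (dual m) (dual (dual m)))), tag q = Some a.
  have [|q [qt _]] := @summand_tens_exists _ (dual m) (dual (dual m)) j' j'' (Some a).
    by rewrite j't j''t.
  have [|q' [q't _]] := @summand_tens_exists _ one (tens (dual m) (dual (dual m))) o1 q (Some a).
    by rewrite o1t qt /= add0r.
  by exists q'.
have tagL (p : summand (tens (tens one (dual m)) (dual (dual m)))) : exists a, tag p = Some a.
  by apply: tag_tens_mm; [apply: copy_tag c1m' | apply: copy_tag copy_m''].
have tagR (p : summand (tens one (tens (dual m) (dual (dual m))))) : exists a, tag p = Some a.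
  have [||a aE] := @tag_tens_mm _ _ _ (origin p).2;
    [exact: copy_tag copy_m' | exact: copy_tag copy_m''|].
  by exists a; rewrite (tag_tensl _ copy_one).
have hinvE q p : entry (hinv (assoc one (dual m) (dual (dual m)))) q p =
    if tag q == tag p then 1 else 0.
  rewrite (@hinv_mult_free _ _ _ _ _ _ _ (fun=> 1)) ?invr1 //.
  - by move=> p'; have [a ->] := tagL p'; apply: exR.
  - by move=> p'; have [a ->] := tagR p'; apply: exL.
  - by move=> _; apply: oner_neq0.
  move=> p' q'; rewrite entry_mk; case: eqP => // pq'.
  case op: (origin p') => [xy k]; case oxy: (origin xy) => [i' j].
  case oq: (origin q') => [i2 yz]; case oyz: (origin yz) => [j2 k2].
  rewrite (copy_eq i' i2 copy_one) (copy_eq j j2 copy_m') (copy_eq k k2 copy_m'') !eqxx /=.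
  by rewrite (copy_tag i2 copy_one) (copy_tag j2 copy_m') (copy_tag k2 copy_m'').
rewrite (entry_comp_copy _ _ _ _ o2 c11) (entry_hinv_runit _ _ copy_one) mulr1.
have [z zt] := exL 0; have [w wt] := exR 0.
rewrite entry_comp (bigD1 w) //= [X in _ + X]big1 ?addr0 => [|w' nw']; last first.
  rewrite [X in _ * X]entry_neq ?mulr0 // (copy_tag o2 c11).
  by rewrite eq_sym; apply: contraNneq nw' => w'0; apply/eqP; apply: mfR; rewrite w'0 wt.
rewrite entry_tensm wt (copy_tag o2 c11) eqxx entry_id.
rewrite (copy_eq (origin o2).1 (origin w).1 copy_one) eqxx mul1r.
rewrite entry_coev -(tag_tensl _ copy_one) wt eqxx mulr1.
rewrite entry_comp (bigD1 z) //= [X in _ + X]big1 ?addr0 => [|z' nz']; last first.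
  rewrite hinvE wt ifN ?mulr0 //.
  by rewrite eq_sym; apply: contraNneq nz' => z'0; apply/eqP; apply: mfL; rewrite z'0 zt.
rewrite hinvE wt zt eqxx mulr1 entry_tensm zt v0 eqxx entry_id.
by rewrite (copy_eq (origin z).2 (origin v).2 copy_m'') eqxx mulr1 (copy_eq (origin z).1 i c1m').
Qed.

Lemma entry_hinv_piv p q : entry (hinv (piv m)) q p = (Num.sg tau)%:C.
Proof.
have mm := copy_mult_free copy_m; have mm'' := copy_mult_free copy_m''.
have t0 : tau != 0 by apply: contraNneq (tau_neq0 tau_sqr) => ->.
have s2 : (Num.sg tau)%:C * (Num.sg tau)%:C = 1 :> C.
  by rewrite -rmorphM /= -expr2 sqr_sg t0.
have s0 : (Num.sg tau)%:C != 0 :> C.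
  by apply: contra_eq_neq s2 => ->; rewrite mul0r eq_sym oner_eq0.
rewrite (@hinv_mult_free _ _ _ _ _ _ _ (fun=> (Num.sg tau)%:C)) //.
- rewrite (copy_tag p copy_m) (copy_tag q copy_m'') /=.
  by apply: (mulfI s0); rewrite divff.
- by move=> p'; exists q; rewrite (copy_tag p' copy_m) (copy_tag q copy_m'').
- by move=> p'; exists p; rewrite (copy_tag p copy_m) (copy_tag p' copy_m'').
move=> p' q'; rewrite entry_mk; case: eqP => // _.
by rewrite (tagged_copy p' copy_m) (tagged_copy q' copy_m'') (copy_tag p' copy_m).
Qed.

(** The entry of the isomorphism T(n) (x) m -> T(n+1) from the summand over y of
    T(n) (x) m to q.  There is one such summand for every simple summand of
    y (x) m, and only the one of the same type as q contributes; the sum avoids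
    naming it. *)
Definition tpow_entry n (y : summand (tpow m n)) (q : summand (tpow m n.+1)) : C :=
  \sum_(v : summand (tens (tpow m n) m) | (origin v).1 == y) entry (tpow_assoc m n) v q.

Lemma entry_dualB_piv Y (g : hom (tens one (dual m)) Y) o (z : summand (tens Y m)) i :
  (forall y : summand Y, tag y = None) ->
  entry (Defs.comp (tensm (idm Y) (hinv (piv m))) (dualB g)) o z =
  if tag z == Some 0 then (Num.sg tau)%:C * entry g i (origin z).1 else 0.
Proof.
move=> Ym; case: eqVneq => [z0|nz0]; last first.
  by apply: entry_neq; rewrite (copy_tag o copy_one) eq_sym.
have [j'' [j''t _]] := copy_m''.
have [|v [v0 vo]] := @summand_tens_exists _ Y (dual (dual m)) (origin z).1 j'' (Some 0).
  by rewrite Ym j''t.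
rewrite entry_comp (bigD1 v) //= [X in _ + X]big1 ?addr0 => [|v' nv'].
  rewrite (entry_dualB _ _ i) // vo /= entry_tensm v0 z0 eqxx vo /= entry_id eqxx mul1r.
  by rewrite entry_hinv_piv.
rewrite entry_tensm z0 entry_id; case: eqP => [v'0|]; last by rewrite mul0r.
case: eqP => [yE|]; last by rewrite !mul0r.
case/eqP: nv'; apply: summand_tens_inj; first by rewrite v'0.
rewrite vo -yE; case: (origin v') => y j /=.
by rewrite (copy_eq j j'' copy_m'').
Qed.

(** The matrix of the map E. *)
Lemma entry_FSmap n (f : hom one (tpow m n.+2)) o q :
  (forall y : summand (tpow m n.+1), tag y = None) -> tag q = Some 0 ->
  entry (@FSmap C TY m n.+1 f) o q =
  \sum_(q' : summand (tpow m n.+2))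
    (Num.sg tau)%:C * @tpow_entry n.+1 (origin q').2 q * entry f o q'.
Proof.
move=> Ym q0.
have c1m' : is_copy None (tens one (dual m)) by apply: copy_tensl copy_one copy_m'.
have cm'1 : is_copy None (tens (dual m) one) by apply: copy_tensr copy_m' copy_one.
have [i1 [i1t _]] := c1m'; have [i2 _] := cm'1; have [j' _] := copy_m'.
transitivity (\sum_(z : summand (tens (tpow m n.+1) m))
   \sum_(q' : summand (tpow m n.+2)) if (origin z).1 == (origin q').2 then
     (Num.sg tau)%:C * entry (tpow_assoc m n.+1) z q * entry f o q' else 0); last first.
  rewrite exchange_big /=; apply: eq_bigr => q' _.
  rewrite /tpow_entry -[RHS]mulrA mulr_suml mulr_sumr [RHS]big_mkcond /=.
  by apply: eq_bigr => z _; case: eqP => // _; rewrite mulrA.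
pose f' : hom one (tens m (tpow m n.+1)) := f.
pose g : hom (tens one (dual m)) (tpow m n.+1) :=
  Defs.comp (Defs.comp (dualA f') (hinv (runit (dual m)))) (lunit (dual m)).
have -> : @FSmap C TY m n.+1 f = Defs.comp (tpow_assoc m n.+1)
    (Defs.comp (tensm (idm (tpow m n.+1)) (hinv (piv m))) (dualB g)).
  rewrite /FSmap (_ : hinv (tpowS m n.+1) = ty_id R (tpow m n.+2)); last exact: hinv_idm.
  by rewrite [RHS]ty_compA /g -[f']ty_comp1f.
rewrite entry_comp; apply: eq_bigr => z _; rewrite (entry_dualB_piv _ _ _ i1 Ym).
case: eqP => [z0|/eqP nz0]; last first.
  rewrite mulr0 big1 // => q' _; rewrite (entry_neq (tpow_assoc m n.+1)) ?q0 //.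
  by rewrite mulr0 mul0r if_same.
rewrite /g (entry_comp_copy _ _ _ _ j' copy_m') entry_lunit.
rewrite (copy_eq (origin i1).2 j' copy_m') eqxx mulr1.
rewrite (entry_comp_copy _ _ _ _ i2 cm'1) (entry_hinv_runit _ _ copy_m') mulr1.
rewrite (entry_dualA Ym _ _ _ o) mulrA mulr_sumr [LHS]big_mkcond /=; apply: eq_bigr => q' _.
by rewrite eq_sym [_ * (Num.sg tau)%:C]mulrC.
Qed.

End FSmapEntries.

(** * The indicator as a sum over paths *)

Section Step.
Variables (R : realType) (A : finZmodType) (chi : A -> A -> R[i]) (tau : R).
Variables X Y Z M : ty_obj A.
Hypotheses (Xm : is_copy None X) (Mm : is_copy None M).
Implicit Types (phi : ty_hom R (ty_tens Y M) Z).

(** The recursion step in the construction of the isomorphism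
    T(n) (x) m -> T(n+1), starting from an arbitrary phi : Y (x) M -> Z. *)
Lemma entry_tensm_assoc phi (v : summand (ty_tens (ty_tens X Y) M))
    (q : summand (ty_tens X Z)) :
  tag v = tag q ->
  entry (ty_comp (ty_tensm (ty_id R X) phi) (ty_assoc chi tau X Y M)) v q =
  (\sum_(w : summand (ty_tens Y M) | (origin w).1 == (origin (origin v).1).2)
     entry phi w (origin q).2)
  * ty_F chi tau None (tag (origin (origin v).1).2) None
      (tag (origin v).1) (tag (origin q).2) (tag q).
Proof.
move=> vq; have [i0 [i0t _]] := Xm; rewrite entry_comp.
pose H (w : summand (ty_tens Y M)) := entry phi w (origin q).2 *
  (if (origin w).1 == (origin (origin v).1).2 then
     ty_F chi tau None (tag (origin (origin v).1).2) None
      (tag (origin v).1) (tag w) (tag q) else 0).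
transitivity (\sum_(w : summand (ty_tens X (ty_tens Y M)))
    if tag w == tag q then H (origin w).2 else 0).
  apply: eq_bigr => w _; rewrite entry_tensm; case: eqP => wq; last by rewrite mul0r.
  rewrite entry_id (copy_eq (origin w).1 (origin q).1 Xm) eqxx mul1r /H; congr (_ * _).
  rewrite entry_mk vq wq eqxx.
  case: (origin v) => xy k /=; case: (origin xy) => i j /=.
  case: (origin w) => i' yz /=; case: (origin yz) => j' k' /=.
  rewrite (copy_eq i i' Xm) (copy_eq k k' Mm) !eqxx andbT /= eq_sym.
  by rewrite (copy_tag i' Xm) (copy_tag k' Mm).
rewrite (sum_summand_tens (fun u _ w => if u == tag q then H w else 0)).
rewrite (big_copy _ i0 Xm) i0t mulr_suml [RHS]big_mkcond /=.
apply: eq_bigr => w _; rewrite -big_mkcondr /=.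
have [wq|nwq] := eqVneq (tag w) (tag (origin q).2); last first.
  rewrite /H entry_neq // !mul0r if_same big1 //.
rewrite (big_pred1 (tag q)) => [|u]; first by rewrite /H wq; case: eqP; rewrite ?mulr0.
have /= := origin_fusion q; rewrite (copy_tag _ Xm) -wq => fq.
by case: (eqVneq u (tag q)) => [->|_]; rewrite ?andbT ?andbF ?fq.
Qed.

Lemma sum_entry_tensm_assoc phi (y : summand (ty_tens X Y)) (q : summand (ty_tens X Z)) :
  fusion (tag y) None (tag q) ->
  \sum_(v : summand (ty_tens (ty_tens X Y) M) | (origin v).1 == y)
    entry (ty_comp (ty_tensm (ty_id R X) phi) (ty_assoc chi tau X Y M)) v q =
  (\sum_(w : summand (ty_tens Y M) | (origin w).1 == (origin y).2)
     entry phi w (origin q).2)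
  * ty_F chi tau None (tag (origin y).2) None (tag y) (tag (origin q).2) (tag q).
Proof.
move=> yq; have [k [kt _]] := Mm.
have [|v [vt vo]] := @summand_tens_exists _ (ty_tens X Y) M y k (tag q).
  by rewrite kt.
rewrite (bigD1 v) /= ?vo // entry_tensm_assoc // vo /=.
rewrite [X in _ + X]big1 ?addr0 // => v' /andP[/eqP v'y nv'].
rewrite entry_neq //; apply: contraNneq nv' => v'q.
apply/eqP; apply: summand_tens_inj; rewrite ?v'q //.
by rewrite vo -v'y; case: (origin v') => a b /=; rewrite (copy_eq b k Mm).
Qed.

End Step.

Section HomFromOne.
Variables (R : realType) (A : finZmodType) (X Y : ty_obj A).
Local Notation index := {pq : summand X * summand Y | tag pq.1 == tag pq.2}.

Lemma entry_val (f : ty_hom R X Y) (pq : index) : entry f (\val pq).1 (\val pq).2 = f pq.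
Proof. by rewrite /entry -surjective_pairing valK. Qed.

Lemma sum_hom_copy s (F : summand Y -> R[i]) : is_copy s X ->
  \sum_(pq : index) F (\val pq).2 = \sum_(q | tag q == s) F q.
Proof.
move=> Xs; have [o [os _]] := Xs.
pose h (pq : index) := (\val pq).2.
have h_inj : injective h.
  move=> pq pq' hh; apply/val_inj; move: hh; rewrite /h.
  case: (\val pq) (\val pq') => p q [p' q'] /= ->.
  by rewrite (copy_eq p p' Xs).
rewrite [RHS](eq_bigl [in h @: setT]) => [|q /=].
  rewrite big_imset /= => [|? ? _ _]; last exact: h_inj.
  by apply: eq_bigl => q; rewrite in_setT.
apply/eqP/imsetP => [qs|[pq _ ->]].
  have oq : tag (o, q).1 == tag (o, q).2 by rewrite /= os qs.
  by exists (exist _ (o, q) oq); rewrite ?in_setT.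
by rewrite /h -(eqP (valP pq)) (copy_tag _ Xs).
Qed.

End HomFromOne.

Section Recursion.
Variables (R : realType) (A : finZmodType) (chi : A -> A -> R[i]) (tau : R).
Hypotheses (chiB : bicharacter chi) (chiS : bichar_symmetric chi)
  (chiN : bichar_nondegenerate chi).
Hypothesis (tau_sqr : tau ^+ 2 = (#|A|%:R)^-1).
Local Notation C := R[i].
Local Notation S := (option A).
Local Notation TY := (TY chi tau).
Local Notation m := (ty_m chi tau).
Local Notation one := (Defs.one TY).
Local Notation T n := (tpow m n).
Implicit Types X Y Z W : TY.

(** The summand of T(n+1) from which a summand of T(n+2) = m (x) T(n+1)
    originates. *)
Definition prev n (q : summand (T n.+2)) : summand (T n.+1) := (origin q).2.

Lemma prev_fusion n (q : summand (T n.+2)) : fusion None (tag (prev q)) (tag q).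
Proof.
have := origin_fusion q; rewrite -/(prev q).
by rewrite (copy_tag (X := m) (origin q).1 (copy_m chi tau)).
Qed.

(** Odd powers of m are multiples of m, even ones are sums of elements of A. *)
Lemma tpow_tag n (q : summand (T n.+1)) : (tag q == None) = ~~ odd n.
Proof.
elim: n q => [|n IHn] q; first by rewrite (copy_tag q (copy_m chi tau)).
have := prev_fusion q; have := IHn (prev q); rewrite /=.
by case: (tag (prev q)) (tag q) => [a|] [b|] //=; case: (odd n).
Qed.

Lemma tpow_entry1 (y : summand (T 1)) (q : summand (T 2)) :
  @tpow_entry _ _ chi tau 1 y q = 1.
Proof.
rewrite /tpow_entry (bigD1 q) /=; last first.
  by rewrite (copy_eq (X := m) (origin q).1 y (copy_m chi tau)).
rewrite entry_id eqxx big1 ?addr0 // => v /andP[_ /negPf nvq].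
by rewrite entry_id nvq.
Qed.

Lemma tpow_entryS n (y : summand (T n.+2)) (q : summand (T n.+3)) :
  @tpow_entry _ _ chi tau n.+2 y q = @tpow_entry _ _ chi tau n.+1 (prev y) (prev q)
     * ty_F chi tau None (tag (prev y)) None (tag y) (tag (prev q)) (tag q).
Proof.
have cm := copy_m chi tau.
apply: (@sum_entry_tensm_assoc R A chi tau m (T n.+1) (T n.+2) m cm cm (tpow_assoc m n.+1) y q).
have := tpow_tag y; have := tpow_tag q; rewrite /=.
by case: (tag y) (tag q) => [a|] [b|] //=; case: (odd n).
Qed.

(** The weight of the path that ends at q: the diagonal entry of the map E, up to
    the sign sgn(tau). *)
Definition path_weight n (q : summand (T n.+2)) : C :=
  @tpow_entry _ _ chi tau n.+1 (prev q) q.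

Lemma path_weightS n (q : summand (T n.+3)) :
  path_weight q = path_weight (prev q) *
    ty_F chi tau None (tag (prev (prev q))) None (tag (prev q)) (tag (prev q)) (tag q).
Proof. exact: tpow_entryS. Qed.

(** The sum Z_(k+1)(w) of the weights of the paths of T(2k+2) that end in w. *)
Definition path_sum k (w : A) : C :=
  \sum_(q : summand (T k.*2.+2) | tag q == Some w) path_weight q.

Lemma FSind_path_sum k : @FSind C TY k.*2.+2 m = (Num.sg tau)%:C * path_sum k 0.
Proof.
have co := copy_one chi tau; rewrite /FSind.
pose K (pq pq' : {pq : summand one * summand (T k.*2.+2) | tag pq.1 == tag pq.2}) : C :=
  (Num.sg tau)%:C * @tpow_entry _ _ chi tau k.*2.+1 (prev (\val pq').2) (\val pq).2.
rewrite (@ltrace_kernel _ _ K); last first.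
  move=> v pq; rewrite -[LHS]entry_val.
  have q0 : tag (\val pq).2 = Some 0 by rewrite -(eqP (valP pq)); apply: copy_tag co.
  have Ym (y : summand (T k.*2.+1)) : tag y = None.
    by apply/eqP; rewrite tpow_tag odd_double.
  rewrite (entry_FSmap chiB chiS chiN tau_sqr v (\val pq).1 Ym q0).
  set o := (\val pq).1.
  transitivity (\sum_(q' : summand (T k.*2.+2) | tag q' == Some 0)
     (Num.sg tau)%:C * @tpow_entry _ _ chi tau k.*2.+1 (prev q') (\val pq).2 * entry v o q').
    rewrite [RHS]big_mkcond; apply: eq_bigr => q' _; case: eqP => // nq'.
    by rewrite (entry_neq v) ?mulr0 // (copy_tag o co) eq_sym; apply/eqP.
  rewrite -(sum_hom_copy _ co); apply: eq_bigr => pq' _.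
  by rewrite /K (copy_eq o (\val pq').1 co) entry_val.
rewrite /K (sum_hom_copy
  (fun q => (Num.sg tau)%:C * @tpow_entry _ _ chi tau k.*2.+1 (prev q) q) co).
by rewrite -mulr_sumr.
Qed.

Lemma path_sum0 w : path_sum 0 w = 1.
Proof.
have cm := copy_m chi tau; have [i [it _]] := cm.
have [|q [qt _]] := @summand_tens_exists _ m m i i (Some w); first by rewrite it.
rewrite /path_sum (big_pred1 (q : summand (T 2))) => [|q' /=]; first exact: tpow_entry1.
apply/eqP/eqP => [q'w|->] //; apply: (mult_free_tens cm cm).
by rewrite q'w qt.
Qed.

(** Two more factors m prolong a path that ends in a to one that ends in w, at
    the cost of the entries tau chi(a,a)^-1 and chi(a,w). *)
Lemma path_sumS k w : path_sum k.+1 w =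
  \sum_a tau%:C * (chi a a)^-1 * chi a w * path_sum k a.
Proof.
have cm := copy_m chi tau; have [i [it _]] := cm.
have YA (y : summand (T k.*2.+2)) : tag y != None by rewrite tpow_tag /= odd_double.
have Ym (y : summand (T k.*2.+3)) : tag y = None.
  by apply/eqP; rewrite tpow_tag /= odd_double.
pose G (q2 : summand (T k.*2.+2)) : C := path_weight q2 *
  (if tag q2 is Some a then tau%:C * (chi a a)^-1 * chi a w else 0).
transitivity (\sum_(q2 : summand (T k.*2.+2)) G q2); last first.
  under [RHS]eq_bigr do rewrite mulr_sumr big_mkcond /=.
  rewrite exchange_big /=; apply: eq_bigr => q _; rewrite /G.
  case: (tag q) (YA q) => // a _; rewrite (bigD1 a) //= eqxx mulrC big1 ?addr0 // => b nb.
  by rewrite ifN //; apply: contraNneq nb => -[->].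
pose p2 (q : summand (T k.*2.+4)) : summand (T k.*2.+2) := prev (prev q : summand (T k.*2.+3)).
transitivity (\sum_(q : summand (T k.*2.+4)) if tag q == Some w then G (p2 q) else 0).
  rewrite [LHS]big_mkcond; apply: eq_bigr => q _; case: eqP => // qw.
  rewrite (@path_weightS k.*2.+1 q) (@path_weightS k.*2 (prev q)) qw (Ym (prev q)) /G -/(p2 q).
  have := YA (p2 q); have := @prev_fusion k.*2 (p2 q).
  case: (tag (p2 q)) => // a _ _.
  have -> : tag (prev (p2 q)) = None.
    by apply/eqP; rewrite tpow_tag odd_double.
  by rewrite /= -mulrA.
rewrite (sum_summand_tens
  (fun u _ (y : summand (T k.*2.+3)) => if u == Some w then G (prev y) else 0)).
rewrite (big_copy _ i cm) it.
transitivity (\sum_(y : summand (T k.*2.+3)) G (prev y)).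
  apply: eq_bigr => y _; rewrite Ym big_fusion_mm (bigD1 w) //= eqxx.
  by rewrite big1 ?addr0 // => b nb; rewrite ifN //; apply: contraNneq nb => -[->].
exact: (@big_tens_mYZ R A m (T k.*2.+2) G cm YA).
Qed.

End Recursion.

(** * Gaussian binomial coefficients at roots of unity *)

Section GaussianBinomial.
Variables (F : comNzRingType) (q : F).

(** The Gaussian binomial coefficient [n choose k] at q, by its Pascal rule, so
    that no division is needed. *)
Fixpoint qbin n k : F :=
  match n, k with
  | _, 0%N => 1
  | 0%N, _.+1 => 0
  | n'.+1, k'.+1 => qbin n' k' + q ^+ k * qbin n' k
  end.

Lemma qbinS n k : qbin n.+1 k.+1 = qbin n k + q ^+ k.+1 * qbin n k.+1.
Proof. by []. Qed.

Lemma qbin_small n k : (n < k)%N -> qbin n k = 0.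
Proof.
elim: n k => [|n IHn] [|k] // nk.
by rewrite qbinS !IHn ?mulr0 ?addr0 // ltnW.
Qed.

Lemma qbin0 n : qbin n 0 = 1. Proof. by case: n. Qed.

Lemma qbin_col n k : (k <= n)%N ->
  (1 - q ^+ k.+1) * qbin n k.+1 = (1 - q ^+ (n - k)) * qbin n k.
Proof.
elim: n k => [|n IHn] k kn.
  by move: kn; rewrite leqn0 => /eqP->; rewrite subn0 /= expr0 subrr mulr0 mul0r.
have step j : (j <= n)%N ->
    (1 - q ^+ j.+1) * qbin n.+1 j.+1 = (1 - q ^+ n.+1) * qbin n j.
  move=> jn; rewrite qbinS mulrDr mulrCA IHn //.
  have -> : q ^+ n.+1 = q ^+ j.+1 * q ^+ (n - j) by rewrite -exprD addSn subnKC.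
  ring.
case: k kn => [|j] kn.
  by rewrite step // subn0 !qbin0.
rewrite subSS [in RHS]qbinS [RHS]mulrDr -IHn //.
have [jn|nj] := ltnP j n; last first.
  have -> : j = n by apply/eqP; rewrite eqn_leq nj -ltnS kn.
  by rewrite !qbin_small ?ltnS ?leqnSn // subnn expr0 subrr; ring.
rewrite step //.
have -> : q ^+ n.+1 = q ^+ j.+1 * q ^+ (n - j) by rewrite -exprD addSn subnKC 1?ltnW.
ring.
Qed.

Lemma qbin_absorb n k : (k <= n)%N ->
  (1 - q ^+ k.+1) * qbin n.+1 k.+1 = (1 - q ^+ n.+1) * qbin n k.
Proof.
move=> kn; rewrite qbinS mulrDr mulrCA qbin_col //.
have -> : q ^+ n.+1 = q ^+ k.+1 * q ^+ (n - k) by rewrite -exprD addSn subnKC.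
ring.
Qed.

(** The alternating sum of the Gaussian binomial coefficients. *)
Definition qbin_alt n : F := \sum_(j < n.+1) (-1) ^+ j * qbin n j.

(** By the Pascal rule the alternating sum for n+2 is
    - sum_j (-1)^j (1 - q^j) [n+1 choose j], to which the absorption identity
    applies. *)
Lemma qbin_alt_rec n : qbin_alt n.+2 = (1 - q ^+ n.+1) * qbin_alt n.
Proof.
have -> : qbin_alt n.+2 =
    - \sum_(j < n.+2) (-1) ^+ j * qbin n.+1 j
    + \sum_(j < n.+2) (-1) ^+ j * (q ^+ j * qbin n.+1 j).
  rewrite /qbin_alt big_ord_recl expr0 mul1r qbin0.
  have -> : \sum_(i < n.+2) (-1) ^+ lift ord0 i * qbin n.+2 (lift ord0 i) =
    - \sum_(j < n.+2) (-1) ^+ j * qbin n.+1 j +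
    \sum_(j < n.+2) (-1) ^+ j.+1 * (q ^+ j.+1 * qbin n.+1 j.+1).
    rewrite -sumrN -big_split; apply: eq_bigr => j _.
    by rewrite lift0 qbinS /= !exprS; ring.
  rewrite addrCA; congr (_ + _).
  rewrite [RHS]big_ord_recl expr0 qbin0 !mul1r; congr (_ + _).
  rewrite big_ord_recr [qbin _ _](@qbin_small n.+1 n.+2) //=.
  by rewrite !(mulr0, addr0); apply: eq_bigr => j _; rewrite /bump add1n.
rewrite -sumrN -big_split big_ord_recl /= expr0 [X in X + _](_ : _ = 0) ?add0r; last by ring.
rewrite /qbin_alt mulr_sumr; apply: eq_bigr => j _.
rewrite [RHS]mulrCA -qbin_absorb -1?ltnS // /bump /= add1n !exprS; ring.
Qed.

Lemma qbin_alt_even h : qbin_alt h.*2 = \prod_(i < h) (1 - q ^+ i.*2.+1).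
Proof.
elim: h => [|h IHh]; first by rewrite /qbin_alt big_ord_recl !big_ord0 expr0 mul1r addr0.
by rewrite doubleS qbin_alt_rec IHh big_ord_recr mulrC.
Qed.

End GaussianBinomial.

(** At q = w^-1 with w of order n = 2h+1, the coefficient [n-1 choose j] is
    (-1)^j w^(j(j+1)/2), so the alternating sum has no signs left. *)
Lemma sum_prim_root_triangular (F : fieldType) (w : F) h :
  h.*2.+1.-primitive_root w ->
  \sum_(j < h.*2.+1) w ^+ 'C(j.+1, 2) = \prod_(i < h) (1 - w^-1 ^+ i.*2.+1).
Proof.
move=> wp; have w0 : w != 0 by rewrite (prim_root_eq0 wp).
rewrite -qbin_alt_even /qbin_alt; apply: eq_bigr => -[j /= jh] _.
elim: j jh => [|j IHj] jh; first by rewrite qbin0 expr0 mul1r.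
have jh' := ltnW jh.
have wj : 1 - w^-1 ^+ j.+1 != 0.
  rewrite subr_eq0 exprVn eq_sym invr_eq1 -(prim_order_dvd wp).
  by apply/negP => /dvdn_leq; rewrite ltn0Sn leqNgt jh => /(_ isT).
apply: (mulfI wj); rewrite mulrCA qbin_col; last by rewrite -ltnS.
have -> : w^-1 ^+ (h.*2 - j) = w ^+ j.+1.
  apply: (mulfI (expf_neq0 (h.*2 - j) w0)); rewrite exprVn divff ?expf_neq0 //.
  by rewrite -exprD addnS subnK -1?ltnS // (prim_expr_order wp).
rewrite binS bin1 exprD exprVn IHj // [(-1) ^+ j.+1]exprS.
have : w ^+ j.+1 != 0 by rewrite expf_neq0.
by move: (w ^+ j.+1) (qbin _ _ _) ((-1) ^+ j) => x y s x0; field.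
Qed.

(** * The quadratic Gauss sum *)

Section AdditiveCharacter.
Variables (R : realType) (p : nat).
Hypotheses (p_prime : prime p).
Local Notation C := R[i].
Local Notation e := (@efp R p).
Local Notation z := (e 1).

Lemma expr_cis (t : R) n : (cos t +i* sin t) ^+ n = cos (t * n%:R) +i* sin (t * n%:R).
Proof.
elim: n => [|n IHn]; first by rewrite expr0 mulr0 cos0 sin0.
rewrite exprSr IHn -natr1 mulrDr mulr1 cosD sinD; simpc.
by congr (_ +i* _); rewrite addrC; congr (_ + _); rewrite mulrC.
Qed.

Lemma Fp_ltn (x : 'F_p) : (x < p)%N.
Proof. by have := ltn_ord x; rewrite [X in (_ < X)%N -> _]Fp_cast. Qed.

Lemma nat_Fp1 : nat_of_ord (1 : 'F_p) = 1%N.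
Proof. by rewrite (val_Fp_nat p_prime 1) modn_small // prime_gt1. Qed.

Lemma efpE x : e x = z ^+ x.
Proof. by rewrite /efp expr_cis nat_Fp1 mulr1 mulrAC. Qed.

Lemma p_neq0 : p%:R != 0 :> R.
Proof. by rewrite pnatr_eq0 -lt0n prime_gt0. Qed.

Lemma efp1_prim : p.-primitive_root z.
Proof.
have zp : z ^+ p = 1.
  rewrite /efp expr_cis nat_Fp1 mulr1 divfK ?p_neq0 //.
  by rewrite mulrC mulr_natr cos2pi sin2pi.
have z1 : z != 1.
  apply/eqP => /(congr1 (@complex.Re R)); rewrite /efp nat_Fp1 mulr1 /=.
  have -> : 2 * pi / p%:R = (pi / p%:R) *+ 2 :> R by rewrite -[RHS]mulr_natl mulrA.
  have s0 : 0 < sin (pi / p%:R) :> R.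
    apply: sin_gt0_pi; rewrite divr_gt0 ?pi_gt0 ?ltr0n ?prime_gt0 //=.
    by rewrite ltr_pdivrMr ?ltr0n ?prime_gt0 // ltr_pMr ?pi_gt0 // ltr1n prime_gt1.
  rewrite cos_mulr2n cos2sin2 => h.
  have : sin (pi / p%:R) ^+ 2 = 0 :> R by lra.
  by move/eqP; rewrite sqrf_eq0 gt_eqF.
have [d dp ddvd] := prim_order_exists (prime_gt0 p_prime) zp.
case/primeP: p_prime => _ /(_ d ddvd) /orP[/eqP d1|/eqP dE]; last by move: dp; rewrite dE.
by move: (prim_expr_order dp) z1; rewrite d1 expr1 => ->; rewrite eqxx.
Qed.
Let zP := efp1_prim.

Lemma efp_nat n : e n%:R = z ^+ n.
Proof. by rewrite efpE val_Fp_nat // (prim_expr_mod zP). Qed.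

Lemma efpD x y : e (x + y) = e x * e y.
Proof. by rewrite -[x]natr_Zp -[y]natr_Zp -natrD !efp_nat exprD. Qed.

Lemma efp0 : e 0 = 1. Proof. by rewrite efpE expr0. Qed.

Lemma efp_inj : injective e.
Proof.
move=> x y xy; have /eqP : (nat_of_ord x == nat_of_ord y %[mod p])%N.
  by rewrite -(eq_prim_root_expr zP) -!efpE xy.
by rewrite !modn_small ?Fp_ltn //; apply: ord_inj.
Qed.

Lemma efp_neq0 x : e x != 0.
Proof.
by rewrite efpE expf_neq0 // (prim_root_eq0 zP) -lt0n prime_gt0.
Qed.

Lemma efpN x : e (- x) = (e x)^-1.
Proof. by apply: (mulfI (efp_neq0 x)); rewrite -efpD subrr efp0 divff ?efp_neq0. Qed.

Lemma efpMn x n : e (x *+ n) = e x ^+ n.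
Proof. by elim: n => [|n IHn]; rewrite ?efp0 // mulrS efpD IHn exprS. Qed.

Lemma efp_sum (I : Type) (s : seq I) (P : pred I) (F : I -> 'F_p) :
  e (\sum_(i <- s | P i) F i) = \prod_(i <- s | P i) e (F i).
Proof. exact: (big_morph _ efpD efp0). Qed.

Lemma conj_efp x : ((e x)^*)%C = e (- x).
Proof.
rewrite efpN; apply: (mulfI (efp_neq0 x)); rewrite divff ?efp_neq0 // /efp.
set t : R := _ / _; apply/eqP; rewrite eq_complex /=; apply/andP; split; apply/eqP.
  by rewrite -(cos2Dsin2 t); ring.
ring.
Qed.

Lemma sum_efp_mul (a : 'F_p) : a != 0 -> \sum_x e (a * x) = 0.
Proof.
move=> a0; have z1 : 1 - z != 0.
  by rewrite subr_eq0 eq_sym -efp0; apply: contra_neq (oner_neq0 'F_p) => /efp_inj.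
apply: (mulIf z1); rewrite mul0r mulrBr mulr1; apply/eqP; rewrite subr_eq0; apply/eqP.
rewrite mulr_suml (reindex_inj (addIr a^-1)) /=; apply: eq_bigr => x _.
by rewrite mulrDr divff // efpD.
Qed.

End AdditiveCharacter.

Section GaussSum.
Variables (R : realType) (p : nat).
Hypotheses (p_prime : prime p) (p_odd : odd p).
Local Notation C := R[i].
Local Notation e := (@efp R p).
Local Notation z := (e 1).

(** The quadratic Gauss sum. *)
Definition gauss_sum : C := \sum_(x : 'F_p) e (x ^+ 2).

Lemma two_neq0 : 2 != 0 :> 'F_p.
Proof.
apply/eqP => /(congr1 (fun x : 'F_p => nat_of_ord x)); rewrite val_Fp_nat // modn_small //.
by rewrite ltn_neqAle prime_gt1 // andbT; apply: contraTneq p_odd => <-.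
Qed.

Lemma gauss_sum_normsq : gauss_sum * (gauss_sum^*)%C = p%:R.
Proof.
have -> : (gauss_sum^*)%C = \sum_(x : 'F_p) e (- x ^+ 2).
  by rewrite /gauss_sum rmorph_sum; apply: eq_bigr => x _; apply: conj_efp.
rewrite /gauss_sum big_distrlr /= exchange_big /=.
under eq_bigr => y _ do rewrite (reindex_inj (addIr y)) /=.
transitivity (\sum_(x : 'F_p) \sum_(y : 'F_p) e (x ^+ 2) * e ((2 * x) * y)).
  rewrite exchange_big /=; apply: eq_bigr => x _; apply: eq_bigr => y _.
  by rewrite -!efpD //; congr e; ring.
rewrite (bigD1 0) //= [X in _ + X]big1 ?addr0 => [|x x0]; last first.
  by rewrite -mulr_sumr sum_efp_mul ?mulr0 // mulf_neq0 // two_neq0.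
rewrite (eq_bigr (fun=> 1)) => [|y _]; last by rewrite expr0n mulr0 mul0r !efp0 // mulr1.
by rewrite sumr_const card_Fp.
Qed.

(* h = (p-1)/2 *)
Let h := p./2.
Lemma half_doubleS : h.*2.+1 = p.
Proof. by rewrite -[RHS]odd_double_half p_odd. Qed.

(** With h = (p-1)/2 one has (j-h)^2 = j(j+1) + h^2 modulo p, so the Gauss sum is
    z^(h^2) times the sum of (z^2)^(j(j+1)/2); and h^2 is the sum of the first h
    odd numbers, which spreads z^(h^2) over the factors of the product. *)
Lemma gauss_sum_prod : gauss_sum = \prod_(i < h) (z ^+ i.*2.+1 - (z ^+ i.*2.+1)^-1).
Proof.
have zP := efp1_prim R p_prime.
have z0 : z != 0 by apply: efp_neq0.
have wP : h.*2.+1.-primitive_root (z ^+ 2).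
  by rewrite half_doubleS (prim_root_exp_coprime _ zP) coprime2n.
have := sum_prim_root_triangular wP; rewrite half_doubleS => gE.
have sumodd : (\sum_(i < h) i.*2.+1 = h * h)%N.
  elim: (h) => [|n IHn]; first by rewrite big_ord0.
  by rewrite big_ord_recr /= IHn; lia.
transitivity (z ^+ (h * h) * \sum_(j < p) (z ^+ 2) ^+ 'C(j.+1, 2)); last first.
  rewrite gE -sumodd -prodrXr -big_split /=; apply: eq_bigr => i _.
  rewrite mulrBr mulr1; congr (_ - _).
  rewrite exprVn -exprM mulnC exprM.
  by have := expf_neq0 i.*2.+1 z0; move: (z ^+ _) => x x0; field.
rewrite /gauss_sum mulr_sumr (reindex_inj (addIr (- h%:R))) /=.
have cF := Fp_cast p_prime.
rewrite (reindex (cast_ord (esym cF))) /=; last first.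
  by exists (cast_ord cF) => x _; rewrite ?cast_ordK ?cast_ordKV.
apply: eq_bigr => j _.
have -> : cast_ord (esym cF) j = (j : nat)%:R :> 'F_p.
  by apply: val_inj; rewrite /= val_Fp_nat // modn_small.
rewrite -exprM -exprD -efp_nat //; congr e.
have -> : (2 * 'C(j.+1, 2) = j.+1 * j)%N.
  by rewrite mulnC -[2%N in LHS]/(2`!)%N bin_ffact ffactnS ffactn1.
rewrite natrD !natrM -natr1.
have p0 : 2 * h%:R + 1 = 0 :> 'F_p.
  by rewrite -natrM natr1 mul2n half_doubleS pchar_Fp_0.
apply/eqP; rewrite -subr_eq0; apply/eqP.
by rewrite -[RHS](mulr0 (- j%:R)) -[in RHS]p0; ring.
Qed.

(** The product has real factors 2 sin(2 pi j / p), up to i^h; those with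
    j > p/2 are negative and there are (p div 4) of them. *)
Lemma gauss_sum_val : gauss_sum = eps_p R p * (Num.sqrt p%:R)%:C.
Proof.
pose s i : R := 2 * sin (2 * pi / p%:R * i.*2.+1%:R).
have p0 : p%:R != 0 :> R by apply: p_neq0.
have pR : 0 < p%:R :> R by rewrite ltr0n prime_gt0.
have gE : gauss_sum = 'i ^+ h * (\prod_(i < h) s i)%:C.
  rewrite gauss_sum_prod rmorph_prod /= -[h in 'i ^+ h]card_ord -prodr_const -big_split /=.
  apply: eq_bigr => i _.
  rewrite -efp_nat // -efpN // -conj_efp // subcJ efp_nat // /efp expr_cis nat_Fp1 // mulr1 /=.
  by rewrite mulrC rmorphM /= rmorph_nat.
set P := \prod_(i < h) s i in gE.
have P2 : P ^+ 2 = p%:R.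
  apply: (@complexI R); rewrite rmorphXn rmorph_nat -gauss_sum_normsq gE rmorphM rmorphXn.
  rewrite [X in _ * (_ * X)](conjc_real P).
  rewrite mulrACA -expr2 -exprMn.
  have -> : 'i * ('i^*)%C = 1 :> C by simpc.
  by rewrite expr1n mul1r expr2.
have spos i : (i.*2.+1 <= h)%N -> 0 < s i.
  move=> ih; rewrite mulr_gt0 // sin_gt0_pi //; apply/andP; split.
    by rewrite mulr_gt0 ?ltr0n // divr_gt0 // mulr_gt0 ?pi_gt0.
  rewrite mulrAC ltr_pdivrMr // mulrAC mulrC ltr_pM2l ?pi_gt0 //.
  by rewrite -natrM ltr_nat -half_doubleS; lia.
have sneg i : (h < i.*2.+1)%N -> (i < h)%N -> 0 < - s i.
  move=> hi ih; rewrite /s -mulrN mulr_gt0 //.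
  have -> : 2 * pi / p%:R * (i.*2.+1)%:R =
      (2 * pi / p%:R * (i.*2.+1)%:R - pi) + pi :> R by ring.
  rewrite sinDpi opprK sin_gt0_pi //.
  have -> : 2 * pi / p%:R * (i.*2.+1)%:R - pi = pi * ((2 * i.*2.+1)%:R / p%:R - 1) :> R.
    by rewrite natrM; field.
  have i1 : p%:R < (2 * i.*2.+1)%:R :> R by rewrite ltr_nat -half_doubleS; lia.
  have i2 : (2 * i.*2.+1)%:R < 2 * p%:R :> R by rewrite -natrM ltr_nat -half_doubleS; lia.
  rewrite pmulr_rgt0 ?pi_gt0 // gtr_pMr ?pi_gt0 //.
  by rewrite subr_gt0 ltr_pdivlMr // mul1r i1 ltrBlDr ltr_pdivrMr.
pose m := (p %/ 4)%N.
have hm i : (i.*2.+1 <= h)%N = (i < h - m)%N by rewrite /h /m; lia.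
have Psgn n : (n <= h)%N -> 0 < (-1) ^+ (n - (h - m)) * \prod_(i < n) s i.
  elim: n => [_|n IHn nh]; first by rewrite sub0n expr0 big_ord0 mulr1.
  have := IHn (ltnW nh); rewrite big_ord_recr /=.
  have [nm|mn] := ltnP n (h - m).
    have /eqP -> : (n.+1 - (h - m) == 0)%N by rewrite subn_eq0.
    have /eqP -> : (n - (h - m) == 0)%N by rewrite subn_eq0 ltnW.
    by rewrite !mul1r => P0; rewrite mulr_gt0 // spos // hm.
  rewrite subSn // exprS => P0.
  have -> : -1 * (-1) ^+ (n - (h - m)) * (\prod_(i < n) s i * s n) =
    (-1) ^+ (n - (h - m)) * (\prod_(i < n) s i) * - s n by ring.
  by rewrite mulr_gt0 // sneg // ltnNge hm -leqNgt.
have := Psgn h (leqnn h); rewrite -/P subKn; last by rewrite /h /m; lia.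
move=> P0.
have PE : P = (-1) ^+ m * Num.sqrt p%:R.
  have -> : p%:R = ((-1) ^+ m * P) ^+ 2 :> R by rewrite exprMn sqrr_sign mul1r.
  by rewrite sqrtr_sqr gtr0_norm // signrMK.
rewrite gE PE rmorphM rmorph_sign mulrA; congr (_ * _).
rewrite /eps_p; case: eqP => p4.
  have -> : h = (2 * m)%N by rewrite /h /m; lia.
  by rewrite exprM sqr_i -exprD addnn -mul2n exprM sqrrN !expr1n.
have -> : h = (2 * m).+1 by rewrite /h /m; move: p4 p_odd; lia.
by rewrite exprSr exprM sqr_i mulrAC -exprD addnn -mul2n exprM sqrrN !expr1n mul1r.
Qed.

End GaussSum.

(** * Legendre symbols and quadratic sums in one variable *)

Section Legendre.
Variable p : nat.
Hypotheses (p_prime : prime p) (p_odd : odd p).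
Implicit Types a b : 'F_p.

Lemma Fp_generator : exists g : 'F_p, g != 0 /\ forall a, a != 0 -> exists n, a = g ^+ n.
Proof.
have /cyclicP[u uE] := field_unit_group_cyclic [group of [set: {unit 'F_p}]].
exists (val u); split; first by rewrite -unitfE; apply: valP.
move=> a; rewrite -unitfE => aU; pose a' := FinRing.Unit aU.
have : a' \in <[u]>%g by rewrite -uE inE.
case/cycleP=> n an; exists n.
by have := congr1 val an; rewrite /= FinRing.val_unitX.
Qed.

Lemma legendre_sqr b : b != 0 -> legendre (b ^+ 2) = 1.
Proof.
move=> b0; rewrite /legendre sqrf_eq0 (negPf b0).
by case: existsP => // -[]; exists b.
Qed.

Lemma legendre0 : legendre (0 : 'F_p) = 0. Proof. by rewrite /legendre eqxx. Qed.

Lemma legendre1 : legendre (1 : 'F_p) = 1.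
Proof. by rewrite -(expr1n _ 2) legendre_sqr ?oner_neq0. Qed.

Lemma neg1_neq1 : -1 != 1 :> 'F_p.
Proof. by rewrite eq_sym -addr_eq0 (two_neq0 p_prime p_odd). Qed.

(** A generator is not a square, so the squares are its even powers. *)
Lemma legendre_expg (g : 'F_p) n : g != 0 ->
  (forall a, a != 0 -> exists n, a = g ^+ n) -> legendre (g ^+ n) = (-1) ^+ n.
Proof.
move=> g0 gen.
have gns : ~ exists x, x ^+ 2 = g.
  case=> y yg; have y0 : y != 0 by apply: contraNneq g0 => y0; rewrite -yg y0 expr0n.
  (* if g were a square, squaring would be onto, hence injective *)
  pose sq (x : 'F_p) := x ^+ 2.
  have sq_onto x : exists x', sq x' = x.
    have [->|/gen[k ->]] := eqVneq x 0; first by exists 0; rewrite /sq expr0n.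
    by exists (y ^+ k); rewrite /sq -exprM mulnC exprM yg.
  have : {in predT &, injective sq}.
    apply/image_injP/eqP; apply: eq_card => x.
    by have [x' <-] := sq_onto x; rewrite fintype.image_f.
  move=> /(_ (-1) 1 isT isT).
  by rewrite /sq sqrrN => /(_ erefl)/eqP; rewrite (negPf neg1_neq1).
rewrite -[n]odd_double_half -muln2; move: (odd n) n./2 => b k.
have gk0 : g ^+ k != 0 by rewrite expf_neq0.
rewrite !exprD !exprM sqrr_sign mulr1; case: b; last by rewrite !expr0 mul1r legendre_sqr.
rewrite !expr1 /legendre mulf_eq0 sqrf_eq0 (negPf g0) (negPf gk0) /=.
case: existsP => // -[x /eqP xg]; case: gns; exists (x / g ^+ k).
by rewrite expr_div_n xg mulfK // sqrf_eq0.
Qed.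

Lemma legendreM a b : legendre (a * b) = legendre a * legendre b.
Proof.
have [->|a0] := eqVneq a 0; first by rewrite mul0r legendre0 mul0r.
have [->|b0] := eqVneq b 0; first by rewrite mulr0 legendre0 mulr0.
have [g [g0 gen]] := Fp_generator.
have [i ->] := gen a a0; have [j ->] := gen b b0.
by rewrite -exprD !legendre_expg // exprD.
Qed.

Lemma legendreX a n : legendre (a ^+ n) = legendre a ^+ n.
Proof. by elim: n => [|n IHn]; rewrite ?legendre1 // !exprS legendreM IHn. Qed.

Lemma legendre_sq1 a : a != 0 -> legendre a * legendre a = 1.
Proof. by move=> a0; rewrite -legendreM legendre_sqr. Qed.

Lemma legendreV a : legendre a^-1 = legendre a.
Proof.
have [->|a0] := eqVneq a 0; first by rewrite invr0.
rewrite -[LHS]mul1r -(legendre_sq1 a0) -mulrA -[legendre a * legendre a^-1]legendreM.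
by rewrite divff // legendre1 mulr1.
Qed.

Lemma card_sqrt a : #|[set x : 'F_p | x ^+ 2 == a]|%:Z = 1 + legendre a.
Proof.
rewrite /legendre; case: eqVneq => [->|a0].
  have -> : [set x : 'F_p | x ^+ 2 == 0] = [set 0].
    by apply/setP => x; rewrite !inE sqrf_eq0.
  by rewrite cards1.
case: existsP => [[x /eqP xa]|nx]; last first.
  by rewrite eq_card0 // => x; rewrite inE; apply/negP => xa; case: nx; exists x.
have x0 : x != 0 by apply: contraNneq a0 => x0; rewrite -xa x0 expr0n.
have -> : [set x : 'F_p | x ^+ 2 == a] = [set x; - x].
  by apply/setP => y; rewrite !inE -xa eqf_sqr.
rewrite cards2 -addr_eq0 -mulr2n -mulr_natl mulf_neq0 //; exact: two_neq0.
Qed.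

End Legendre.

Section QuadraticSums.
Variables (R : realType) (p : nat).
Hypotheses (p_prime : prime p) (p_odd : odd p).
Local Notation C := R[i].
Local Notation e := (@efp R p).
Local Notation g := (gauss_sum R p).
Local Notation leg a := ((legendre a)%:~R : C).

Lemma sum_efp_sqr a : a != 0 -> \sum_(x : 'F_p) e (a * x ^+ 2) = leg a * g.
Proof.
have key c : c != 0 ->
    \sum_(x : 'F_p) e (c * x ^+ 2) = leg c * \sum_(y : 'F_p) leg y * e y.
  move=> c0; rewrite (partition_big (fun x => x ^+ 2) xpredT) //=.
  transitivity (\sum_(y : 'F_p) (1 + leg y) * e (c * y)).
    apply: eq_bigr => y _; rewrite (eq_bigr (fun=> e (c * y))) => [|x /eqP-> //].
    rewrite sumr_const -mulr_natl; congr (_ * _).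
    have /(congr1 (fun n => n%:~R : C)) := card_sqrt p_prime p_odd y.
    rewrite rmorphD /= => <-; rewrite -pmulrn.
    by congr (_%:R); apply: eq_card => x; rewrite !inE.
  transitivity (\sum_(y : 'F_p) e (c * y) + \sum_(y : 'F_p) leg y * e (c * y)).
    by rewrite -big_split /=; apply: eq_bigr => y _; rewrite mulrDl mul1r.
  rewrite sum_efp_mul // add0r (reindex_inj (mulfI (invr_neq0 c0))) mulr_sumr.
  apply: eq_bigr => y _; rewrite legendreM // legendreV // rmorphM /= mulrA.
  by rewrite mulVKf.
move=> a0; rewrite key //; congr (_ * _).
have := key 1 (oner_neq0 _); rewrite legendre1 mul1r => <-.
by apply: eq_bigr => x _; rewrite mul1r.
Qed.

(** Conjugating the Gauss sum multiplies it by the Legendre symbol of -1. *)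
Lemma eps_p_sqr : eps_p R p ^+ 2 = leg (-1 : 'F_p).
Proof.
have m10 : -1 != 0 :> 'F_p by rewrite oppr_eq0 oner_neq0.
have gc : (g^*)%C = leg (-1 : 'F_p) * g.
  rewrite -sum_efp_sqr // /gauss_sum rmorph_sum; apply: eq_bigr => x _.
  by rewrite mulN1r; apply: conj_efp.
have sp0 : Num.sqrt p%:R != 0 :> R by rewrite gt_eqF // sqrtr_gt0 ltr0n prime_gt0.
have sp0' : (Num.sqrt p%:R)%:C != 0 :> C by apply: contraNneq sp0 => /complexI ->.
move: gc; rewrite gauss_sum_val // rmorphM /= => gc.
have {gc} : ((eps_p R p)^*)%C = leg (-1 : 'F_p) * eps_p R p.
  by apply: (mulIf sp0'); rewrite -mulrA -gc; congr (_ * _); apply/esym/conjc_real.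
rewrite /eps_p; case: ifP => _.
  by rewrite mulr1 conjc1 expr1n.
have i0 : 'i != 0 :> C by rewrite eq_complex /= oner_eq0 andbF.
rewrite sqr_i => ec; apply: (mulIf i0); rewrite -ec; simpc.
by congr (_ +i* _); rewrite oppr0.
Qed.

End QuadraticSums.

(** * Quadratic sums over vector spaces *)

Section QuadraticForms.
Variables (R : realType) (p : nat).
Hypotheses (p_prime : prime p) (p_odd : odd p).
Local Notation C := R[i].
Local Notation e := (@efp R p).
Local Notation g := (gauss_sum R p).
Local Notation leg a := ((legendre a)%:~R : C).

(** The Gauss sum of the quadratic form v B v^T. *)
Definition quad_sum n (B : 'M['F_p]_n) : C := \sum_(v : 'rV_n) e ((v *m B *m v^T) 0 0).

Lemma quad_sum_congr n (P B : 'M['F_p]_n) :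
  P \in unitmx -> quad_sum (P *m B *m P^T) = quad_sum B.
Proof.
move=> Pu; rewrite /quad_sum [RHS](reindex_inj (can_inj (mulmxK Pu))) /=.
by apply: eq_bigr => v _; rewrite trmx_mul !mulmxA.
Qed.

Lemma quad_sum_block n (c : 'M['F_p]_1) (S : 'M['F_p]_n) :
  quad_sum (block_mx c 0 0 S) = (\sum_(x : 'F_p) e (c 0 0 * x ^+ 2)) * quad_sum S.
Proof.
rewrite /quad_sum big_distrlr /= pair_big /=.
rewrite (reindex (fun xw : 'F_p * 'rV['F_p]_n => row_mx xw.1%:M xw.2)) /=; last first.
  exists (fun v : 'rV_(1 + n) => (lsubmx v 0 0, rsubmx v)) => [[x w] _|v _] /=.
    by rewrite row_mxKl row_mxKr !mxE eqxx.
  by rewrite -mx11_scalar hsubmxK.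
apply: eq_bigr => -[x w] _ /=.
rewrite -efpD // mul_row_block !mulmx0 addr0 add0r tr_row_mx mul_row_col; congr e.
rewrite [in LHS]mxE; congr (_ + _).
by rewrite tr_scalar_mx mul_mx_scalar mul_scalar_mx !mxE; ring.
Qed.

(** A non-degenerate symmetric form has a non-isotropic vector, by polarisation. *)
Lemma sym_form_nonzero n (B : 'M['F_p]_n.+1) :
  B^T = B -> \det B != 0 -> exists v : 'rV_n.+1, (v *m B *m v^T) 0 0 != 0.
Proof.
move=> Bs dB; apply/existsP; apply: contraNT dB; rewrite negb_exists => /forallP vB.
pose b (v w : 'rV['F_p]_n.+1) := (v *m B *m w^T) 0 0.
have b0 v : b v v = 0 by apply/eqP; have := vB v; rewrite negbK.
have bS v w : b v w = b w v.
  rewrite /b; have <- : (w *m B *m v^T)^T = v *m B *m w^T by rewrite !trmx_mul trmxK Bs mulmxA.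
  by rewrite mxE.
suff -> : B = 0 by rewrite det0.
apply/matrixP => i j; rewrite [RHS]mxE.
have -> : B i j = b (delta_mx 0 i) (delta_mx 0 j).
  by rewrite /b -rowE trmx_delta -colE !mxE.
have := b0 (delta_mx 0 i + delta_mx 0 j).
have bDl u v w : b (u + v) w = b u w + b v w by rewrite /b !mulmxDl mxE.
have bDr u v w : b u (v + w) = b u v + b u w by rewrite /b linearD mulmxDr mxE.
rewrite bDl !bDr !b0 add0r addr0 [b (delta_mx 0 j) _]bS -mulr2n -mulr_natl => /eqP.
by rewrite mulf_eq0 (negPf (two_neq0 p_prime p_odd)) => /eqP.
Qed.

Lemma unitmx_extend n (v : 'rV['F_p]_n.+1) : v != 0 ->
  exists2 P : 'M_n.+1, P \in unitmx & exists c, v = c *: row 0 P.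
Proof.
move=> v0; exists (row_ebase v); first exact: row_ebase_unit.
exists (col_ebase v 0 0).
rewrite -{1}[v]mulmx_ebase rank_rV v0 [col_ebase v]mx11_scalar mul_scalar_mx.
rewrite -scalemxAl mxE eqxx mulr1n rowE; congr (_ *: (_ *m _)).
by apply/matrixP => i j; rewrite !mxE !ord1 eqxx /= andbC; case: j => -[].
Qed.

Lemma quad_sum_det n (B : 'M['F_p]_n) : B^T = B -> \det B != 0 ->
  quad_sum B = leg (\det B) * g ^+ n.
Proof.
elim: n B => [|n IHn] B Bs dB.
  rewrite det_mx00 legendre1 // expr0 mulr1 /quad_sum (big_pred1 0) => [|v].
    by rewrite mul0mx mul0mx mxE efp0.
  by rewrite /= [v]thinmx0 eqxx.
have [v vB] := sym_form_nonzero Bs dB.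
have v0 : v != 0 by apply: contraNneq vB => ->; rewrite !mul0mx mxE.
(* In a basis that starts with v, the form splits as its value c on v plus the
   Schur complement S. *)
have [P Pu [a va]] := unitmx_extend v0.
have [M MP] : exists M : 'M['F_p]_(1 + n), M = P *m B *m P^T.
  by exists (P *m B *m P^T).
have Ms : M^T = M by rewrite MP !trmx_mul trmxK Bs mulmxA.
have M00 : M 0 0 != 0.
  apply: contraNneq vB => M0; rewrite va linearZ /= -!scalemxAl -scalemxAr !scalerA.
  have rowM : (row 0 P *m B *m (row 0 P)^T) 0 0 = M 0 0.
    by rewrite tr_row colE mulmxA -!row_mul -colE -MP [LHS]mxE [LHS]mxE.
  by rewrite mxE rowM M0 mulr0.
set c := M 0 0 in M00.
pose u := ursubmx M; pose S := drsubmx M - c^-1 *: (u^T *m u).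
have cE : ulsubmx M = c%:M.
  rewrite [LHS]mx11_scalar; congr (_%:M); rewrite !mxE /c; congr (M _ _); exact: val_inj.
have dlE : dlsubmx M = u^T by rewrite /u trmx_ursub Ms.
pose L : 'M['F_p]_(1 + n) := block_mx 1%:M 0 (c^-1 *: u^T) 1%:M.
have ME : M = L *m block_mx c%:M 0 0 S *m L^T.
  rewrite /L tr_block_mx !mulmx_block.
  rewrite !(mul1mx, mulmx0, mul0mx, addr0, add0r, trmx1, trmx0, mulmx1).
  rewrite mul_mx_scalar mul_scalar_mx linearZ /= trmxK !scalerA divff // !scale1r.
  by rewrite -scalemxAr addrC /S subrK -cE -dlE submxK.
have Lu : L \in unitmx by rewrite unitmxE /L det_lblock !det1 mulr1 unitr1.
have Ss : S^T = S.
  by rewrite /S linearB /= linearZ /= trmx_mul trmxK trmx_drsub Ms.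
have detM : \det M = c * \det S.
  by rewrite ME !det_mulmx det_tr /L det_lblock det_ublock !det1 !mul1r mulr1 det_scalar1.
have dP : \det P != 0 by rewrite -unitfE -unitmxE.
have detB : \det M = \det P ^+ 2 * \det B.
  by rewrite MP !det_mulmx det_tr expr2; ring.
have dS : \det S != 0.
  apply: contraNneq dB => S0; move/eqP: detB.
  by rewrite detM S0 mulr0 eq_sym mulf_eq0 sqrf_eq0 (negPf dP).
rewrite -(quad_sum_congr B Pu) -MP [in LHS]ME quad_sum_congr // quad_sum_block IHn //.
rewrite mxE eqxx mulr1n sum_efp_sqr // exprS.
have -> : leg (\det B) = leg c * leg (\det S).
  by rewrite -rmorphM -legendreM // -detM detB legendreM // legendre_sqr // mul1r.
ring.
Qed.

End QuadraticForms.

(** * Bicharacters as bilinear forms *)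

Section BicharacterForm.
Variables (R : realType) (p r : nat).
Hypotheses (p_prime : prime p).
Local Notation C := R[i].
Local Notation e := (@efp R p).
Local Notation V := 'rV['F_p]_r.

Lemma formE (B : 'M['F_p]_r) (v w : V) :
  (v *m B *m w^T) 0 0 = \sum_i \sum_j v 0 i * B i j * w 0 j.
Proof.
rewrite mxE exchange_big /=; apply: eq_bigr => j _.
by rewrite [w^T _ _]mxE [(v *m B) _ _]mxE mulr_suml.
Qed.

Lemma form_delta (B : 'M['F_p]_r) i j :
  ((delta_mx 0 i : V) *m B *m (delta_mx 0 j : V)^T) 0 0 = B i j.
Proof. by rewrite -rowE trmx_delta -colE !mxE. Qed.

Variable chi : V -> V -> C.
Hypotheses (chiB : bicharacter chi) (chiS : bichar_symmetric chi)
  (chiN : bichar_nondegenerate chi).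

(** The values of chi are p-th roots of unity, hence values of e, and chi is
    determined by its values on the standard basis. *)
Lemma bichar_is_form : exists B, forall v w, chi v w = chi_of R B v w.
Proof.
have [nz Dl Dr] := chiB.
have chi0r a : chi a 0 = 1 by apply: bichar0r.
have chi0l a : chi 0 a = 1 by apply: bichar0l.
have chiMn a b n : chi (a *+ n) b = chi a b ^+ n.
  by elim: n => [|n IHn]; rewrite ?chi0l // mulrS Dl IHn exprS.
have chi_sum (I : finType) (F : I -> V) b : chi (\sum_i F i) b = \prod_i chi (F i) b.
  exact: (big_morph (fun a => chi a b) (fun x y => Dl x y b) (chi0l b)).
have chiZ (x : 'F_p) a b : chi (x *: a) b = chi a b ^+ x.
  by rewrite -chiMn -scaler_nat natr_Zp.
have root a b : exists x : 'F_p, chi a b == e x.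
  have /(prim_rootP (efp1_prim R p_prime))[n ->] : chi a b ^+ p = 1.
    by rewrite -chiMn -scaler_nat pchar_Fp_0 // scale0r chi0l.
  by exists n%:R; rewrite efp_nat.
pose B : 'M['F_p]_r := \matrix_(i, j) xchoose (root (delta_mx 0 i) (delta_mx 0 j)).
exists B => v w; rewrite /chi_of formE efp_sum // {1}[v]row_sum_delta chi_sum.
apply: eq_bigr => i _; rewrite efp_sum // chiZ chiS {1}[w]row_sum_delta chi_sum -prodrXl.
apply: eq_bigr => j _; rewrite chiZ -exprM -[v 0 i in RHS]natr_Zp -[w 0 j in RHS]natr_Zp.
rewrite mulrAC -natrM mulr_natl efpMn // mulnC; congr (_ ^+ _); rewrite mxE chiS.
by apply/eqP; apply: (xchooseP (root _ _)).
Qed.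

Lemma Dchi_form : exists B : 'M['F_p]_r, [/\ forall v w, chi v w = e ((v *m B *m w^T) 0 0),
  Dchi chi = legendre (\det B), B^T = B & \det B != 0].
Proof.
have [B [BE DE]] : exists B : 'M['F_p]_r,
    (forall v w, chi v w = e ((v *m B *m w^T) 0 0)) /\ Dchi chi = legendre (\det B).
  rewrite /Dchi /form_of; case: pickP => [B /forallP BE|nB].
    by exists B; split=> // v w; apply/eqP; have /forallP := BE v; apply.
  have [B BE] := bichar_is_form; have /negP[] := nB B.
  by apply/forallP => v; apply/forallP => w; rewrite BE.
exists B; split=> //.
  apply/matrixP => i j; rewrite mxE -!form_delta; apply: (@efp_inj R p p_prime).
  by rewrite -!BE.
apply/negP => /det0P[v v0 vB]; case/eqP: v0; apply: chiN => w.
by rewrite chiS BE vB mul0mx mxE efp0.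
Qed.

End BicharacterForm.

(** * Closed form of the path sums *)

Section ClosedForm.
Variables (R : realType) (p r : nat).
Hypotheses (p_prime : prime p) (p_odd : odd p).
Local Notation C := R[i].
Local Notation e := (@efp R p).
Local Notation V := 'rV['F_p]_r.
Local Notation g := (gauss_sum R p).
Local Notation leg a := ((legendre (a : 'F_p))%:~R : C).

Lemma complete_square (b : V -> V -> 'F_p) (t : 'F_p) (a w : V) :
  (forall u v, b u v = b v u) ->
  (forall u v x, b (u + v) x = b u x + b v x) ->
  (forall y v x, b (y *: v) x = y * b v x) -> t != 0 ->
  let a' := a - (2 * t)^-1 *: w in
  t * b a' a' + b a' w = - (4 * t)^-1 * b w w + t * b a a.
Proof.
move=> bS bDl bZl t0 /=; have two0 := two_neq0 p_prime p_odd.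
have bDr u v x : b u (v + x) = b u v + b u x by rewrite bS bDl ![b u _]bS.
have bZr y v x : b v (y *: x) = y * b v x by rewrite bS bZl bS.
rewrite -scaleNr; set c := - (2 * t)^-1.
have -> : b (a + c *: w) (a + c *: w) = b a a + c * b a w *+ 2 + c ^+ 2 * b w w.
  by rewrite bDl bZl !bDr !bZr [b w a]bS; ring.
rewrite bDl bZl /c.
have four0 : 4 != 0 :> 'F_p by rewrite (_ : 4 = 2 * 2) ?mulf_neq0 // -natrM.
by move: (b a a) (b a w) (b w w) => x y u; field; rewrite t0 four0.
Qed.

Variable B : 'M['F_p]_r.
Hypotheses (Bs : B^T = B) (dB : \det B != 0).
Local Notation b v w := ((v *m B *m w^T) 0 0).

Lemma sum_complete_square (t : 'F_p) (w : V) : t != 0 ->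
  \sum_(a : V) e (t * b a a + b a w) =
  e (- (4 * t)^-1 * b w w) * (leg t ^+ r * leg (\det B) * g ^+ r).
Proof.
move=> t0.
have bS v u : b v u = b u v.
  have <- : (u *m B *m v^T)^T = v *m B *m u^T by rewrite !trmx_mul trmxK Bs mulmxA.
  by rewrite mxE.
have bDl u v x : b (u + v) x = b u x + b v x by rewrite !mulmxDl [LHS]mxE.
have bZl y v x : b (y *: v) x = y * b v x by rewrite -!scalemxAl [LHS]mxE.
have <- : quad_sum R (t *: B) = leg t ^+ r * leg (\det B) * g ^+ r.
  rewrite quad_sum_det //; last 2 first.
  - by rewrite linearZ /= Bs.
  - by rewrite detZ mulf_neq0 // expf_neq0.
  by rewrite detZ legendreM // legendreX // rmorphM rmorphXn.
rewrite /quad_sum mulr_sumr (reindex_inj (addIr (- ((2 * t)^-1 *: w)))) /=.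
apply: eq_bigr => a _; rewrite -(efpD R p_prime); congr e.
have -> : (a *m (t *: B) *m a^T) 0 0 = t * b a a by rewrite -scalemxAr -scalemxAl mxE.
exact: (complete_square (b := fun v w => b v w)).
Qed.

Variables (chi : V -> V -> C) (tau : R).
Hypotheses (chiB : bicharacter chi) (chiS : bichar_symmetric chi)
  (chiN : bichar_nondegenerate chi) (chiE : forall v w, chi v w = e (b v w)).
Hypothesis (tau_sqr : tau ^+ 2 = (#|{: V}|%:R)^-1).

Let s : C := (Num.sg tau)%:C.

Lemma card_rV : #|{: V}| = (p ^ r)%N.
Proof. by rewrite card_mx card_Fp // mul1n. Qed.

Lemma tau_sqrt : tau * Num.sqrt p%:R ^+ r = Num.sg tau.
Proof.
have p0 : 0 < p%:R :> R by rewrite ltr0n prime_gt0.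
have q0 : 0 < Num.sqrt p%:R ^+ r :> R by rewrite exprn_gt0 // sqrtr_gt0.
rewrite {1}[tau]numEsg -mulrA; suff -> : `|tau| * Num.sqrt p%:R ^+ r = 1 by rewrite mulr1.
apply/eqP; rewrite -sqrp_eq1 ?mulr_ge0 ?(ltW q0) // exprMn real_normK ?num_real // tau_sqr.
rewrite card_rV natrX -exprM mulnC exprM sqr_sqrtr ?(ltW p0) //.
by rewrite mulVf // expf_neq0 // gt_eqF.
Qed.

Lemma tau_gauss_sum : tau%:C * g ^+ r = s * eps_p R p ^+ r.
Proof.
rewrite gauss_sum_val // exprMn mulrCA -rmorphXn -rmorphM /= tau_sqrt.
exact: mulrC.
Qed.

(* The ratio of consecutive path sums, up to the factors leg(k). *)
Let L := leg (-2) ^+ r * leg (\det B) * eps_p R p ^+ r * s.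

Lemma sgn_sqr : s ^+ 2 = 1.
Proof.
rewrite /s -rmorphXn /= sqr_sg; case: eqP => // t0.
by have := tau_neq0 tau_sqr; rewrite t0 eqxx.
Qed.

Lemma leg_sqr (a : 'F_p) : a != 0 -> leg a ^+ 2 = 1.
Proof. by move=> a0; rewrite expr2 -rmorphM /= legendre_sq1. Qed.

Lemma neg2_neq0 : -2 != 0 :> 'F_p.
Proof. by rewrite oppr_eq0 two_neq0. Qed.

Lemma L_sqr : L ^+ 2 = leg (-1) ^+ r.
Proof.
rewrite /L !exprMn sgn_sqr mulr1 exprAC leg_sqr ?neg2_neq0 // expr1n mul1r.
by rewrite leg_sqr // mul1r exprAC eps_p_sqr.
Qed.

Lemma path_sum_step k w :
  path_sum chi tau k.+1 w = tau%:C * \sum_(a : V) e (b a w - b a a) * path_sum chi tau k a.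
Proof.
rewrite path_sumS mulr_sumr; apply: eq_bigr => a _.
rewrite -!mulrA; congr (_ * _).
by rewrite mulrA mulrC efpD // efpN // -!chiE [_ * chi a w]mulrC mulrC.
Qed.

(** Here [path_sum k] is Z_(k+1), so that the case distinction is on whether p
    divides k+1. *)
Lemma path_sum_closed k :
  if k.+1%:R == 0 :> 'F_p then
    forall w, path_sum chi tau k w = if w == 0 then L ^+ k.+1 * tau%:C * p%:R ^+ r else 0
  else
    forall w, path_sum chi tau k w =
      L ^+ k * leg k.+1%:R ^+ r * e (k%:R / (2 * k.+1%:R) * b w w).
Proof.
have two0 := two_neq0 p_prime p_odd.
elim: k => [|k IHk].
  rewrite oner_eq0 => w; rewrite path_sum0 expr0 mul1r legendre1 // expr1n mul1r.
  by rewrite !mul0r efp0.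
case: eqVneq IHk => [K0|K0] IHk.
  (* p divides k+1: only a = 0 contributes to the next sum *)
  have K1 : k.+2%:R = 1 :> 'F_p by rewrite -natr1 K0 add0r.
  rewrite K1 oner_eq0 => w; rewrite path_sum_step K0 mul0r mul0r efp0 // mulr1.
  rewrite legendre1 // expr1n mulr1 (bigD1 0) //= [X in _ + X]big1 => [|a /negPf a0].
    rewrite IHk eqxx !mul0mx mxE subr0 efp0 // mul1r addr0.
    transitivity (L ^+ k.+1 * (tau%:C ^+ 2 * p%:R ^+ r)); first by ring.
    by rewrite -natrX -card_rV tau_sqrC // mulr1.
  by rewrite IHk a0 mulr0.
have stepE w : path_sum chi tau k.+1 w = L ^+ k * leg k.+1%:R ^+ r * (tau%:C *
    \sum_(a : V) e ((k%:R / (2 * k.+1%:R) - 1) * b a a + b a w)).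
  rewrite path_sum_step [RHS]mulrCA; congr (_ * _); rewrite mulr_sumr; apply: eq_bigr => a _.
  rewrite IHk mulrCA -(efpD R p_prime); congr (_ * e _).
  by move: (k%:R / _) (b a a) (b a w) => x y u; ring.
(* the coefficient of b a a vanishes exactly when p divides k+2 *)
case: eqVneq => [K1|K1] w; rewrite stepE.
  have km : k.+1%:R = -1 :> 'F_p by apply/eqP; rewrite -addr_eq0 natr1 K1.
  have kE : k%:R = - 2 :> 'F_p.
    by apply: (addIr 1); rewrite natr1 km; ring.
  have -> : k%:R / (2 * k.+1%:R) - 1 = 0 :> 'F_p.
    by rewrite km kE mulrN1 divff ?subrr // oppr_eq0.
  under eq_bigr do rewrite mul0r add0r -chiE chiS.
  rewrite bichar_sum // card_rV natrX km -L_sqr; case: eqP => _; last by rewrite !mulr0.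
  rewrite -exprD addn2; ring.
have tE : k%:R / (2 * k.+1%:R) - 1 = (-2)^-1 * k.+1%:R^-1 * k.+2%:R :> 'F_p.
  have -> : k%:R = k.+1%:R - 1 :> 'F_p by rewrite -natr1 addrK.
  rewrite -[k.+2%:R]natr1; move: (k.+1%:R) K0 => x x0; field.
  by rewrite ?x0 ?two0 ?neg2_neq0.
set t := _ - 1 in tE *.
have t0 : t != 0 by rewrite tE !mulf_neq0 // invr_neq0 // neg2_neq0.
rewrite sum_complete_square //.
have -> : - (4 * t)^-1 = k.+1%:R / (2 * k.+2%:R).
  rewrite tE; have four0 : 4 != 0 :> 'F_p by rewrite (_ : 4 = 2 * 2) ?mulf_neq0 // -natrM.
  move: (k.+1%:R) (k.+2%:R) K0 K1 => x y x0 y0; field.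
  by rewrite ?x0 ?y0 ?four0 ?two0 ?neg2_neq0.
have -> : leg t = leg (-2) * leg k.+1%:R * leg k.+2%:R.
  by rewrite tE !legendreM // !legendreV // !rmorphM.
have legK : leg k.+1%:R ^+ r * leg k.+1%:R ^+ r = 1.
  by rewrite -exprMn -expr2 leg_sqr // expr1n.
rewrite [(_ * leg k.+2%:R) ^+ r]exprMn [(leg (-2) * _) ^+ r]exprMn exprS {2}/L.
transitivity (L ^+ k * (leg k.+1%:R ^+ r * leg k.+1%:R ^+ r) * (tau%:C * g ^+ r) *
   (leg (-2) ^+ r * leg k.+2%:R ^+ r * leg (\det B) * e (k.+1%:R / (2 * k.+2%:R) * b w w))).
  by move: (e _) => E; ring.
rewrite legK tau_gauss_sum; move: (e _) => E; ring.
Qed.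

Lemma path_sum_coprime k : k.+1%:R != 0 :> 'F_p ->
  path_sum chi tau k 0 = L ^+ k * leg k.+1%:R ^+ r.
Proof.
move=> /negPf K0; have := path_sum_closed k; rewrite K0 => ->.
by rewrite !mul0mx mxE mulr0 efp0 // mulr1.
Qed.

Lemma path_sum_multiple k : k.+1%:R = 0 :> 'F_p ->
  path_sum chi tau k 0 = L ^+ k.+1 * s * (Num.sqrt p%:R ^+ r)%:C.
Proof.
move=> K0; have := path_sum_closed k; rewrite K0 eqxx => -> ; rewrite eqxx.
have p0 : 0 <= p%:R :> R by rewrite ler0n.
rewrite -!mulrA; congr (_ * _); rewrite /s -tau_sqrt -rmorphM /= -mulrA -exprMn.
rewrite -expr2 sqr_sqrtr //.
by rewrite rmorphM /= rmorphXn rmorph_nat.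
Qed.

End ClosedForm.

Theorem theorem6p1 (R : realType) (p r : nat)
    (chi : 'rV['F_p]_r -> 'rV['F_p]_r -> R[i]) (tau : R) (k : nat)
    (p_prime : prime p) (p_odd : odd p) (r_ge1 : (1 <= r)%N)
    (chi_bichar : bicharacter chi) (chi_sym : bichar_symmetric chi)
    (chi_nondeg : bichar_nondegenerate chi)
    (tau_sqr : tau ^+ 2 = (#|{: 'rV['F_p]_r}|%:R)^-1) (k_ge1 : (1 <= k)%N) :
  (coprime k p ->
     FSind (2 * k) (ty_m chi tau)
     = (Num.sg tau)%:C ^+ k * eps_p R p ^+ (r * (k + 1))
       * (legendre (- k%:R : 'F_p))%:~R ^+ r
       * (legendre (- 2%:R : 'F_p))%:~R ^+ (r * (k + 1))
       * (Dchi chi)%:~R ^+ (k + 1))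
  /\
  ((p %| k)%N ->
     FSind (2 * k) (ty_m chi tau)
     = (Num.sg tau)%:C ^+ k * eps_p R p ^+ (r * k)
       * (legendre (- 2%:R : 'F_p))%:~R ^+ (r * k)
       * (Dchi chi)%:~R ^+ k
       * (p%:R `^ (r%:R / 2))%:C).
Proof.
have [B [chiE DE Bs dB]] := Dchi_form p_prime chi_bichar chi_sym chi_nondeg.
case: k k_ge1 => // k _.
have -> : (2 * k.+1 = k.*2.+2)%N by rewrite mul2n doubleS.
rewrite (FSind_path_sum chi_bichar chi_sym chi_nondeg tau_sqr k) DE.
have s2 := sgn_sqr tau_sqr; set s := (Num.sg tau)%:C in s2 *.
have dvdE : (p %| k.+1)%N = (k.+1%:R == 0 :> 'F_p) by rewrite (dvdn_pcharf (pchar_Fp p_prime)).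
pose x : R[i] := (legendre (-2 : 'F_p))%:~R; pose d : R[i] := (legendre (\det B))%:~R.
pose M := x ^+ r * d * eps_p R p ^+ r.
have M2 : M ^+ 2 = (legendre (-1 : 'F_p))%:~R ^+ r.
  have L2 : (M * s) ^+ 2 = _ := L_sqr p_prime p_odd dB tau_sqr.
  by rewrite -L2 [RHS]exprMn s2 mulr1.
have M4 : M ^+ 4 = 1.
  by rewrite (exprM M 2 2) M2 exprAC leg_sqr ?expr1n // oppr_eq0 oner_neq0.
have ME n : eps_p R p ^+ (r * n) * x ^+ (r * n) * d ^+ n = M ^+ n.
  by rewrite /M !exprMn -!exprM; ring.
have MsE n : (M * s) ^+ n = M ^+ n * s ^+ n by rewrite exprMn.
split=> [kp|pk].
  have K0 : k.+1%:R != 0 :> 'F_p.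
    by rewrite -dvdE -prime_coprime // coprime_sym.
  have -> : path_sum chi tau k 0 = (M * s) ^+ k * (legendre (k.+1%:R : 'F_p))%:~R ^+ r.
    exact: path_sum_coprime tau_sqr _ K0.
  have -> : (legendre (- k.+1%:R : 'F_p))%:~R ^+ r =
      M ^+ 2 * (legendre (k.+1%:R : 'F_p))%:~R ^+ r.
    by rewrite -mulN1r legendreM // rmorphM /= exprMn -M2.
  set y := (legendre _)%:~R ^+ r; rewrite -/x -/d.
  transitivity (s ^+ k.+1 * (M ^+ 2 * y) * M ^+ (k.+1 + 1)); last first.
    rewrite -[M ^+ (_ + _)]ME.
    move: (eps_p R p ^+ (r * _)) (x ^+ (r * _)) (d ^+ (_ + 1)) (M ^+ 2) => a b c N.
    ring.
  have -> : M ^+ (k.+1 + 1) = M ^+ k * M ^+ 2 by rewrite -exprD addn1 addn2.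
  rewrite MsE exprS -[LHS]mulr1 -M4 (exprD M 2 2); ring.
have K0 : k.+1%:R = 0 :> 'F_p by apply/eqP; rewrite -dvdE.
have -> : path_sum chi tau k 0 = (M * s) ^+ k.+1 * s * (Num.sqrt p%:R ^+ r)%:C.
  exact: path_sum_multiple tau_sqr _ K0.
have -> : p%:R `^ (r%:R / 2) = Num.sqrt p%:R ^+ r :> R.
  by rewrite mulrC powRrM powR12_sqrt ?ler0n // powR_mulrn // sqrtr_ge0.
set z := (_ ^+ r)%:C; rewrite -/x -/d.
transitivity (s ^+ k.+1 * M ^+ k.+1 * z); last first.
  rewrite -ME; move: (eps_p R p ^+ (r * _)) (x ^+ (r * _)) (d ^+ _) => a b c.
  ring.
rewrite MsE; transitivity (s ^+ 2 * s ^+ k.+1 * M ^+ k.+1 * z); first by ring.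
by rewrite s2 mul1r.
Qed.
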